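(* Let $\lambda\in\overline{\mathrm{Pr}}_k$. Then the simple highest weight module $L^{\mathfrak g}_{\mathfrak b}(\lambda)$ (with respect to the standard Borel subalgebra $\mathfrak b$) is a strongly tame $\Gamma_{\rm st}$-Gelfand–Tsetlin $\mathfrak g$-module. Moreover, for every $u\in\overline W$, the module $L^{\mathfrak g}_{u(\mathfrak b)}(u(\lambda))$ is a strongly tame $\Gamma_{\rm st}(u(\Pi_{\rm st}))$-Gelfand–Tsetlin $\mathfrak g$-module.
   Context: Let $\mathfrak g=\mathfrak{sl}_{n+1}(\mathbb C)$, $n\ge1$, $E_{i,j}$ matrix units, $\mathfrak h$ the traceless diagonal matrices, $\Delta_+=\{\varepsilon_i-\varepsilon_j:i<j\}$, $\Delta_-=-\Delta_+$, $\Pi_{\rm st}=(\alpha_1,\dots,\alpha_n)$, $\alpha_i=\varepsilon_i-\varepsilon_{i+1}$, $\mathfrak b$ the upper triangular Borel; $e_i=E_{i,i+1},f_i=E_{i+1,i},h_i=E_{ii}-E_{i+1,i+1}$. $(\cdot,\cdot)$ invariant form on $\mathfrak h^*$ with $(\alpha,\alpha)=2$ for roots; $\omega_i$ fundamental weights, $P^\vee=\bigoplus\mathbb Z\omega_i$, $\rho=\sum\omega_i$; $W$ the Weyl group, $w\cdot\mu=w(\mu+\rho)-\rho$. Admissible weights: fix $k\in\mathbb Q$, $k+n+1=p/q$, $p,q\in\mathbb N$ coprime, $p\ge n+1$; $\overline{\mathrm{Pr}}_{k,\mathbb Z}=\{\sum\lambda_i\omega_i:\lambda_i\in\mathbb N_0,\sum\lambda_i\le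 p-n-1\}$; for $w\in W$, $\eta\in P^\vee$, $C(w,\eta)$ means: for all $\alpha\in\Delta_+$, $0\le(\eta,\alpha)\le q-1$ if $w(\alpha)\in\Delta_+$, $1\le(\eta,\alpha)\le q$ if $w(\alpha)\in\Delta_-$; $\overline{\mathrm{Pr}}_k=\{w\cdot(\mu-\tfrac pq\eta):\mu\in\overline{\mathrm{Pr}}_{k,\mathbb Z},w\in W,\eta\in P^\vee,C(w,\eta)\}$. $\overline W\subset\mathrm{Aut}(\mathfrak g)$ is the group generated by $r_i=\exp(\mathrm{ad}f_i)\exp(-\mathrm{ad}e_i)\exp(\mathrm{ad}f_i)$ ($i=1,\dots,n$) and the involution $\sigma$ with $\sigma(e_i)=e_{n+1-i}$, $\sigma(f_i)=f_{n+1-i}$, $\sigma(h_i)=-h_{n+1-i}$. Elements of $\overline W$ preserve $\mathfrak h$ and so act on $\mathfrak h^*$, on roots, on bases (ordered sets of simple roots) and on Borel subalgebras containing $\mathfrak h$. For $u\in\overline W$ and a $\mathfrak g$-module $M$, $M^u$ is $M$ with action $a\cdot v=u^{-1}(a)v$. For a Borel $\mathfrak b'\supset\mathfrak h$, $L^{\mathfrak g}_{\mathfrak b'}(\mu)$ is the simple highest weight module of highest weight $\mu$ with respect to $\mathfrak b'$. A $\mathfrak g$-module $M$ is a strongly tame $\Gamma_{\rm st}$-Gelfand–Tsetlin module if it has a basis $\{T(v):v\in S\}$ indexed by a set $S$ of arrays $v=(v_{j,i})_{1\le i\le j\le n+1}$ of complex numbers such that for $k=1,\dots,n$: $e_k T(v)=-\sum_{i=1}^k\frac{\prod_{j=1}^{k+1}(v_{k,i}-v_{k+1,j})}{\prod_{j\ne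 i}(v_{k,i}-v_{k,j})}T(v+\delta^{k,i})$, $f_kT(v)=\sum_{i=1}^k\frac{\prod_{j=1}^{k-1}(v_{k,i}-v_{k-1,j})}{\prod_{j\ne i}(v_{k,i}-v_{k,j})}T(v-\delta^{k,i})$, $h_kT(v)=\big(2\sum_{i=1}^kv_{k,i}-\sum_{i=1}^{k-1}v_{k-1,i}-\sum_{i=1}^{k+1}v_{k+1,i}-1\big)T(v)$, where $\delta^{k,i}$ is the array with $1$ at position $(k,i)$ and $0$ elsewhere, summands with vanishing denominator are zero, and $T(w)$ for $w\notin S$ means $0$ (such a basis is an eigenbasis for the standard Gelfand–Tsetlin subalgebra $\Gamma_{\rm st}$ generated by the centers of $U(\mathfrak{gl}_m)$, $m\le n+1$). For a base $\Pi'$, $M$ is a strongly tame $\Gamma_{\rm st}(\Pi')$-Gelfand–Tsetlin module if there is $u\in\overline W$ with $\Pi'=u(\Pi_{\rm st})$ (as ordered sets) such that $M^{u^{-1}}$ is a strongly tame $\Gamma_{\rm st}$-Gelfand–Tsetlin module.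
   Formalization: The stated σ cannot be a Lie algebra automorphism, since σ(h_i)=[σ(e_i),σ(f_i)]=h_{n+1-i}, not -h_{n+1-i}; here σ is the diagram automorphism with σ(e_i)=e_{n+1-i}, σ(f_i)=f_{n+1-i}, and so σ(h_i)=h_{n+1-i}. *)

(* Defs.v *)
(* g = sl_{n+1}(C) with C = R[i], R : realType (i.e. C is the
   field of complex numbers).  Elements of g are the traceless matrices in
   'M[C]_(n.+1).  All indices of the paper (1-based) are kept 1-based where
   the paper's formulas are transcribed (matrix units, GT arrays); weights are
   handled in epsilon-coordinates indexed by 'I_(n.+1) (0-based). *)
From HB Require Import structures.
From mathcomp Require Import all_boot all_order all_algebra all_fingroup.
From mathcomp Require Import reals complex.
Set Implicit Arguments.
Unset Strict Implicit.
Unset Printing Implicit Defensive.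
Import Order.TTheory GRing.Theory Num.Theory.
Local Open Scope ring_scope.

Section Sl.
Variable R : realType.
Local Notation C := R[i].
Variable n : nat.
Local Notation M := 'M[C]_(n.+1).

Definition sl (x : M) : Prop := \tr x = 0.
Definition cartan (x : M) : Prop := is_diag_mx x /\ \tr x = 0.
Definition nplus (x : M) : Prop := forall i j : 'I_n.+1, (j <= i)%N -> x i j = 0.

(* matrix unit E_{a,b}, 1-based indices *)
Definition Eu (a b : nat) : M :=
  \matrix_(i, j) (((i : nat) == a.-1) && ((j : nat) == b.-1))%:R.
Definition gt_e (k : nat) : M := Eu k k.+1.
Definition gt_f (k : nat) : M := Eu k.+1 k.
Definition gt_h (k : nat) : M := Eu k k - Eu k.+1 k.+1.

Definition lie (x y : M) : M := x *m y - y *m x.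

(* exp(ad x) for a nilpotent matrix x (x^(n+1) = 0 implies (ad x)^(2n+1) = 0,
   so the exponential series is this finite sum); used for x = +-e_i, +-f_i. *)
Definition expad (x : M) (y : M) : M :=
  \sum_(m < (2 * n).+2) (m`!%:R)^-1 *: iter m (lie x) y.

Definition rW (k : nat) : M -> M :=
  expad (gt_f k) \o expad (- gt_e k) \o expad (gt_f k).
Definition rWinv (k : nat) : M -> M :=
  expad (- gt_f k) \o expad (gt_e k) \o expad (- gt_f k).

(* sigma : the involution with sigma(e_i) = e_{n+1-i}, sigma(f_i) = f_{n+1-i}:
   sigma(x) = - J x^T J^T with J the signed antidiagonal matrix
   J_{a,n+2-a} = (-1)^a (1-based). *)
Definition Jmx : M :=
  \matrix_(a, b) (if ((a : nat) + b == n)%N then (-1) ^+ (a : nat).+1 else 0).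
Definition sigmaW (x : M) : M := - (Jmx *m x^T *m Jmx^T).

(* The group \overline W, generated by the r_i (1 <= i <= n) and sigma.
   Wbar u ui : u is an element of \overline W and ui is its inverse. *)
Inductive Wbar : (M -> M) -> (M -> M) -> Prop :=
| Wbar_id : Wbar id id
| Wbar_r : forall u ui k, (1 <= k <= n)%N -> Wbar u ui ->
    Wbar (u \o rW k) (rWinv k \o ui)
| Wbar_rinv : forall u ui k, (1 <= k <= n)%N -> Wbar u ui ->
    Wbar (u \o rWinv k) (rW k \o ui)
| Wbar_sigma : forall u ui, Wbar u ui -> Wbar (u \o sigmaW) (sigmaW \o ui).

(* simple root alpha_k (1-based) as a functional on h *)
Definition alpha (k : nat) (x : M) : C :=
  \sum_(a < n.+1 | (a : nat) == k.-1) x a a - \sum_(a < n.+1 | (a : nat) == k) x a a.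

(* u(Pi_st) = u'(Pi_st) as ordered sets: u(alpha_k) = u'(alpha_k) for all k,
   where u(alpha) = alpha o u^{-1} on h. *)
Definition same_base (ui ui' : M -> M) : Prop :=
  forall k, (1 <= k <= n)%N -> forall x, cartan x -> alpha k (ui x) = alpha k (ui' x).

Section Modules.
Variable V : lmodType C.
Variable rho : M -> V -> V.

Definition is_gmod : Prop :=
  [/\ (forall x (a : C) (v w : V), rho x (a *: v + w) = a *: rho x v + rho x w),
      (forall x y (a : C) (v : V), sl x -> sl y ->
          rho (a *: x + y) v = a *: rho x v + rho y v) &
      (forall x y (v : V), sl x -> sl y ->
          rho (lie x y) v = rho x (rho y v) - rho y (rho x v))].

Definition submodule (U : V -> Prop) : Prop :=
  [/\ U 0, (forall v w, U v -> U w -> U (v + w)),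
      (forall (a : C) v, U v -> U (a *: v)) &
      (forall x v, sl x -> U v -> U (rho x v))].

Definition simple_gmod : Prop :=
  (exists v : V, v <> 0) /\
  forall U, submodule U -> (forall v, U v -> v = 0) \/ (forall v, U v).

(* v is a highest weight vector of weight u(lam) for the Borel u(b)
   (u(lam) = lam o u^{-1} on h, u(b) = u(h + n_+)). *)
Definition hw_vector (u : M -> M) (lam : M -> C) (v : V) : Prop :=
  [/\ v <> 0,
      (forall x, cartan x -> rho (u x) v = lam x *: v) &
      (forall x, nplus x -> rho (u x) v = 0)].

(* an array v = (v_{j,i}), 1 <= i <= j <= n+1, entry v j i (1-based);
   entries outside the triangle are required to be 0. *)
Definition arr := nat -> nat -> C.
Definition delta (k i : nat) : arr := fun j l => ((j == k) && (l == i))%:R.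
Definition arr_add (v w : arr) : arr := fun j l => v j l + w j l.
Definition arr_sub (v w : arr) : arr := fun j l => v j l - w j l.

Definition coef_e (v : arr) (k i : nat) : C :=
  let num := \prod_(1 <= j < k.+2) (v k i - v k.+1 j) in
  let den := \prod_(1 <= j < k.+1 | j != i) (v k i - v k j) in
  if den == 0 then 0 else num / den.
Definition coef_f (v : arr) (k i : nat) : C :=
  let num := \prod_(1 <= j < k) (v k i - v k.-1 j) in
  let den := \prod_(1 <= j < k.+1 | j != i) (v k i - v k j) in
  if den == 0 then 0 else num / den.
Definition coef_h (v : arr) (k : nat) : C :=
  2 * (\sum_(1 <= i < k.+1) v k i) - (\sum_(1 <= i < k) v k.-1 i)
    - (\sum_(1 <= i < k.+2) v k.+1 i) - 1.

Definition strongly_tame_GT : Prop :=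
  exists (S : arr -> Prop) (T : arr -> V),
  [/\ (forall w, S w -> forall j i, ~~ [&& 1 <= i, i <= j & j <= n.+1]%N -> w j i = 0),
      (forall w, ~ S w -> T w = 0),
      (forall m (w : 'I_m -> arr) (c : 'I_m -> C), injective w ->
          (forall l, S (w l)) -> \sum_(l < m) c l *: T (w l) = 0 ->
          forall l, c l = 0),
      (forall x : V, exists m (w : 'I_m -> arr) (c : 'I_m -> C),
          (forall l, S (w l)) /\ x = \sum_(l < m) c l *: T (w l)) &
      (forall k, (1 <= k <= n)%N -> forall v, S v ->
        [/\ rho (gt_e k) (T v) =
              - \sum_(1 <= i < k.+1) coef_e v k i *: T (arr_add v (delta k i)),
            rho (gt_f k) (T v) =
              \sum_(1 <= i < k.+1) coef_f v k i *: T (arr_sub v (delta k i)) &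
            rho (gt_h k) (T v) = coef_h v k *: T v])].
End Modules.

(* M^{w} : the module M twisted by w (a . v = w^{-1}(a) v); for w = u^{-1}
   the twisted action is a . v = u(a) v. *)
Definition twist_by_inv (V : lmodType C) (rho : M -> V -> V) (u : M -> M) : M -> V -> V :=
  fun x => rho (u x).

Definition strongly_tame_GT_base (V : lmodType C) (rho : M -> V -> V)
    (ui : M -> M) : Prop :=
  exists u' ui', [/\ Wbar u' ui', same_base ui ui' &
                    strongly_tame_GT (twist_by_inv rho u')].

(* weights in epsilon-coordinates c : 'I_(n+1) -> C, i.e. sum_a c_a eps_a;
   its value on x in h is sum_a c_a x_{aa}. *)
Definition wt_val (c : 'I_n.+1 -> C) (x : M) : C := \sum_a c a * x a a.
(* sum_i c_i omega_{i+1}  (i : 'I_n)  in epsilon-coordinates *)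
Definition epsc (c : 'I_n -> C) : 'I_n.+1 -> C :=
  fun a => \sum_(i < n | (a <= i)%N) c i.
Definition rho_eps : 'I_n.+1 -> C := fun a => (n - a)%:R.
(* Weyl group W = S_{n+1} permuting the eps_a *)
Definition wact (w : 'S_n.+1) (c : 'I_n.+1 -> C) : 'I_n.+1 -> C :=
  fun b => c ((w^-1)%g b).
Definition dot_act (w : 'S_n.+1) (c : 'I_n.+1 -> C) : 'I_n.+1 -> C :=
  fun b => wact w (fun a => c a + rho_eps a) b - rho_eps b.

(* condition C(w, eta); positive roots eps_a - eps_b with a < b, and
   (eta, eps_a - eps_b) = sum_{a <= i < b} eta_i *)
Definition Ccond (q : nat) (w : 'S_n.+1) (eta : 'I_n -> int) : Prop :=
  forall a b : 'I_n.+1, (a < b)%N ->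
    let s := \sum_(i < n | (a <= i < b)%N) eta i in
    if (w a < w b)%N then (0 <= s) /\ (s <= (q.-1)%:Z)
    else (1 <= s) /\ (s <= q%:Z).

(* lam in \overline{Pr}_k, k + n + 1 = p/q *)
Definition in_Prbar (p q : nat) (lam : M -> C) : Prop :=
  exists (mu : 'I_n -> nat) (w : 'S_n.+1) (eta : 'I_n -> int),
  [/\ (\sum_i mu i <= p - n.+1)%N,
      Ccond q w eta &
      forall x, cartan x ->
        lam x = wt_val (dot_act w (fun a => epsc (fun i => (mu i)%:R) a
                         - (p%:R / q%:R) * epsc (fun i => (eta i)%:~R) a)) x].

End Sl.

(* Main.v *)
(* Write a = lam + rho in epsilon-coordinates. Admissibility implies that, for i < j,
   a_j - a_i is never a natural number. Let S be the set of arrays with top row a,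
   v_{k+1,i} - v_{k,i} in N, and v_{k+1,j} - v_{k,i} not in N for i < j. On coordinate functions
   on S the Gelfand-Tsetlin formulas satisfy [e_k, f_l] = delta_{kl} h_k: the off-diagonal part
   is an identity of coefficients, the diagonal part a residue computation in which every
   coalescing pair of poles is cancelled by zeros. The Serre relations are not needed: in the
   product of L(lam) with this module the submodule generated by the pair of highest weight
   vectors is spanned by f-monomials, so its lam-weight space is a line, and it is the graph of
   an isomorphism as soon as both factors are simple. On the Gelfand-Tsetlin side simplicity
   follows by comparing consecutive rows: a vector killed by e_1, ..., e_k is supported on
   arrays whose first k+1 rows are aligned, and dually every basis vector is reached by
   lowering operators from the array all of whose rows are truncations of a. Twisting by
   elements of \overline W, which act as Lie algebra automorphisms, gives the second claim. *)
Require Import Defs.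
From HB Require Import structures.
From mathcomp Require Import all_boot all_order all_algebra all_fingroup.
From mathcomp Require Import reals complex boolp.
From mathcomp Require Import zify ring.
Set Implicit Arguments.
Unset Strict Implicit.
Unset Printing Implicit Defensive.
Import Order.TTheory GRing.Theory Num.Theory.
Local Open Scope ring_scope.

(** * Residue identities for rational functions *)

(** The difference of the monic polynomials with roots [s] and [r] has degree less than |A|, hence
    equals its Lagrange interpolation at the nodes [r t]; the identity compares the coefficients of
    degree |A| - 1. *)
Lemma Lagrange_residue_sum (F : fieldType) (T : finType) (A : pred T)
    (r s : T -> F) : {in A &, injective r} ->
  \sum_(t | A t) (\prod_(t' | A t') (r t - s t'))
      / (\prod_(t' | A t' && (t' != t)) (r t - r t'))
  = \sum_(t | A t) (r t - s t).
Proof.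
move=> rI.
(* Only for nonempty [A] is [(size (enum A)).-1] the degree just below the leading one. *)
have [/eqP A0|Apos] := boolP (size (enum A) == 0%N).
  by rewrite -!big_enum (size0nil A0) !big_nil.
pose L t : {poly F} := \prod_(t' | A t' && (t' != t)) ('X - (r t')%:P).
pose ps : {poly F} := \prod_(t <- enum A) ('X - (s t)%:P).
pose pr : {poly F} := \prod_(t <- enum A) ('X - (r t)%:P).
have psE x : ps.[x] = \prod_(t | A t) (x - s t).
  by rewrite horner_prod big_enum /=; apply: eq_bigr => t _; rewrite hornerXsubC.
have LE t x : (L t).[x] = \prod_(t' | A t' && (t' != t)) (x - r t').
  by rewrite horner_prod; apply: eq_bigr => t' _; rewrite hornerXsubC.
have prE x : pr.[x] = \prod_(t | A t) (x - r t).
  by rewrite horner_prod big_enum /=; apply: eq_bigr => t _; rewrite hornerXsubC.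
have pr0 t : A t -> pr.[r t] = 0.
  by move=> At; rewrite prE (bigD1 t) //= subrr mul0r.
have LN0 t : A t -> (L t).[r t] != 0.
  move=> At; rewrite LE; apply/prodf_neq0 => t' /andP[At' tt'].
  by rewrite subr_eq0; apply: contra tt' => /eqP e; apply/eqP/rI.
have sL t : A t -> size (L t) = size (enum A).
  move=> At; rewrite /L -big_filter size_prod_XsubC.
  suff -> : size (enum A) = size (t :: [seq t' <- index_enum T | A t' && (t' != t)]) by [].
  apply/perm_size/uniq_perm; first exact: enum_uniq.
    by rewrite /= filter_uniq ?index_enum_uniq // mem_filter eqxx andbF.
  move=> t'; rewrite mem_enum inE mem_filter mem_index_enum andbT -[t' \in A]/(A t').
  by case: eqVneq => [->|]; rewrite ?andbT // At.
have mL t : L t \is monic by exact: monic_prod_XsubC.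
pose q := ps - pr.
pose q' := \sum_(t | A t) (q.[r t] / (L t).[r t]) *: L t.
(* The leading terms of [ps] and [pr] cancel, so [q - q'] has size at most |A| while it vanishes at
   the |A| distinct nodes. *)
have eq_q : q = q'.
  apply/eqP; rewrite -subr_eq0; apply/eqP.
  apply: (@roots_geq_poly_eq0 _ _ [seq r t | t <- enum A]).
  - apply/allP => _ /mapP[t tA ->]; rewrite mem_enum in tA.
    rewrite /root hornerD hornerN subr_eq0 horner_sum (bigD1 t) //=.
    rewrite hornerZ divfK ?LN0 // big1 ?addr0 // => t' /andP[At' tt'].
    have tP : A t && (t != t') by rewrite eq_sym tt' andbT.
    by rewrite hornerZ (LE t' (r t)) (bigD1 t tP) /= subrr mul0r mulr0.
  - by rewrite map_inj_in_uniq ?enum_uniq // => t t'; rewrite !mem_enum; apply: rI.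
  - rewrite size_map; apply: leq_trans (size_polyD _ _) _.
    rewrite geq_max size_polyN; apply/andP; split; last first.
      rewrite (leq_trans (size_sum _ _ _)) //; apply/bigmax_leqP => t At.
      by rewrite (leq_trans (size_scale_leq _ _)) // sL.
    rewrite -ltnS -(@size_prod_XsubC F _ (enum A) r) -/pr /q.
    apply: (@leq_ltn_trans (size ps).-1); last by rewrite size_prod_XsubC size_prod_XsubC.
    apply/leq_sizeP => j; rewrite size_prod_XsubC /= leq_eqVlt => /predU1P[<-|ltj].
      rewrite coefB; have := monic_prod_XsubC (enum A) predT s.
      have := monic_prod_XsubC (enum A) predT r.
      rewrite !monicE !lead_coefE !size_prod_XsubC /= => /eqP -> /eqP ->.
      by rewrite subrr.
    by rewrite coefB !nth_default ?subrr // size_prod_XsubC.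
have := congr1 (fun p : {poly F} => p`_(size (enum A)).-1) eq_q.
rewrite coef_sum coefB.
have cPn (f : T -> F) :
    (\prod_(t <- enum A) ('X - (f t)%:P))`_(size (enum A)).-1 = - \sum_(t | A t) f t.
  have := @coefPn_prod_XsubC F [seq f t | t <- enum A].
  by rewrite size_map !big_map -[X in _ -> _ = - X]big_enum => ->.
rewrite /ps /pr !cPn opprK addrC sumrB => ->.
apply: eq_bigr => t At; rewrite coefZ -(sL t At) -lead_coefE.
move: (mL t); rewrite monicE => /eqP ->; rewrite mulr1 hornerD hornerN pr0 //.
by rewrite subr0 psE LE.
Qed.

(* Coinciding poles are harmless as long as each of them meets its own zero: such
   factors cancel, and the corresponding summands have numerator 0. *)
Lemma residue_sum (F : fieldType) (T : finType) (r s : T -> F) :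
  (forall t t', t != t' -> r t = r t' -> r t = s t) ->
  \sum_t (\prod_t' (r t - s t')) / (\prod_(t' | t' != t) (r t - r t'))
  = \sum_t (r t - s t).
Proof.
move=> rs; pose A t := r t != s t.
have NA t : ~~ A t -> r t = s t by rewrite negbK => /eqP.
rewrite [RHS](bigID A) [LHS](bigID A) /= [X in _ + X]big1 ?addr0; last first.
  by move=> t /NA e; rewrite (bigD1 t) //= e subrr !mul0r.
rewrite [X in _ = _ + X]big1 ?addr0; last by move=> t /NA ->; rewrite subrr.
rewrite -Lagrange_residue_sum; last first.
  move=> t t' At At' e; apply/eqP/negPn/negP => tt'.
  by move/eqP: At; apply; apply: rs e.
apply: eq_bigr => t At; rewrite [X in X / _](bigID A) /= [X in _ / X](bigID A) /=.
rewrite [X in _ / (_ * X) = _](eq_bigl (fun t' => ~~ A t')); last first.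
  by move=> t' /=; case: eqVneq => //= ->; rewrite At.
rewrite [X in _ / (_ * X) = _](eq_bigr (fun t' => r t - s t')); last first.
  by move=> t' /NA ->.
set Z := \prod_(t' | ~~ A t') _.
have ZN0 : Z != 0.
  apply/prodf_neq0 => t' NAt'; rewrite subr_eq0 -(NA _ NAt').
  apply/eqP => e; move/eqP: (At); apply; apply: (rs t t') => //.
  by apply: contraNneq NAt' => <-.
rewrite -mulf_div divff // mulr1; congr (_ / _).
by apply: eq_bigl => t'; rewrite andbC.
Qed.

(** This is [residue_sum] for the 2k poles x_i and x_i + 1. The terms at x_i + 1 give the first
    products, those at x_i the second ones. Two poles can only meet as x_i = x_l + 1, and then the
    last hypothesis gives each of them its own zero: z_i and y_l + 1. *)
Lemma GT_diagonal_identity (F : fieldType) (k : nat) (x y z : nat -> F) :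
  (1 <= k)%N ->
  (forall i l, (1 <= i <= k)%N -> (1 <= l <= k)%N -> x i = x l -> i = l) ->
  (forall i l, (1 <= i <= k)%N -> (1 <= l <= k)%N -> x i = x l + 1 ->
     [/\ (i < k)%N, x i = z i & x l = y l]) ->
  \sum_(1 <= i < k.+1)
    ((\prod_(1 <= j < k) (x i + 1 - z j))
       / (\prod_(1 <= j < k.+1 | j != i) (x i + 1 - x j))
     * ((\prod_(1 <= j < k.+2) (x i - y j))
       / (\prod_(1 <= j < k.+1 | j != i) (x i - x j)))
     - (\prod_(1 <= j < k.+2) (x i - 1 - y j))
       / (\prod_(1 <= j < k.+1 | j != i) (x i - 1 - x j))
     * ((\prod_(1 <= j < k) (x i - z j))
       / (\prod_(1 <= j < k.+1 | j != i) (x i - x j))))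
  = 2 * (\sum_(1 <= i < k.+1) x i) - (\sum_(1 <= i < k) z i)
    - (\sum_(1 <= i < k.+2) y i) - 1.
Proof.
case: k => // K _ xI xz.
pose r (t : 'I_K.+1 + 'I_K.+1) :=
  match t with inl i => x i.+1 | inr i => x i.+1 + 1 end.
(* The zeros are the k - 1 values z_i and the k + 1 values y_i + 1; the last of these, y_{k+1} + 1,
   fills the slot i = k where there is no z_i. *)
pose s (t : 'I_K.+1 + 'I_K.+1) :=
  match t with
  | inl i => if (i < K)%N then z i.+1 else y K.+2 + 1
  | inr i => y i.+1 + 1
  end.
have rng (i : 'I_K.+1) : (1 <= i.+1 <= K.+1)%N by rewrite ltn_ord.
have rs t t' : t != t' -> r t = r t' -> r t = s t.
  case: t t' => [i|i] [j|j] /= ne e.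
  - by case/negP: ne; apply/eqP; congr inl; apply/ord_inj/succn_inj/xI.
  - by have [iK -> _] := xz _ _ (rng i) (rng j) e; move: iK; rewrite ltnS => ->.
  - by have [_ _ ->] := xz _ _ (rng j) (rng i) (esym e).
  - case/negP: ne; apply/eqP; congr inr; apply/ord_inj/succn_inj/xI => //.
    exact: addIr e.
have := residue_sum rs; rewrite !big_sumType /= => E.
have sumE : \sum_(i < K.+1) (x i.+1 - (if (i < K)%N then z i.+1 else y K.+2 + 1))
    + \sum_(i < K.+1) (x i.+1 + 1 - (y i.+1 + 1))
    = 2 * (\sum_(1 <= i < K.+2) x i) - (\sum_(1 <= i < K.+1) z i)
    - (\sum_(1 <= i < K.+3) y i) - 1.
  rewrite !big_add1 /= !big_mkord.
  under [X in _ + X]eq_bigr => i _ do rewrite opprD addrACA subrr addr0.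
  rewrite !sumrB [X in _ - X + _]big_ord_recr /= ltnn.
  under [X in _ - (X + _) + _]eq_bigr => i _ do rewrite ltn_ord.
  by rewrite [X in _ = _ - X - _]big_ord_recr /=; ring.
rewrite -sumE -{}E big_add1 /= big_mkord addrC -big_split /=.
apply: eq_bigr => i _.
rewrite !big_sumType /=.
have pz c : \prod_(j < K.+1) (c - (if (j < K)%N then z j.+1 else y K.+2 + 1))
   = (\prod_(1 <= j < K.+1) (c - z j)) * (c - y K.+2 - 1).
  rewrite big_ord_recr /= ltnn big_add1 big_mkord; congr (_ * _); last by ring.
  by apply: eq_bigr => j _; rewrite ltn_ord.
have py c : \prod_(j < K.+1) (c - (y j.+1 + 1)) * (c - y K.+2 - 1)
   = \prod_(1 <= j < K.+3) (c - 1 - y j).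
  rewrite big_add1 big_mkord [RHS]big_ord_recr /=; congr (_ * _); last by ring.
  by apply: eq_bigr => j _; ring.
have px c : \prod_(j < K.+1 | j != i) (c - x j.+1)
   = \prod_(1 <= j < K.+2 | j != i.+1) (c - x j).
  by rewrite big_add1 big_mkord; apply: eq_bigl => j; rewrite eqSS.
have px1 c : \prod_(j < K.+1 | j != i) (c - (x j.+1 + 1))
   = \prod_(1 <= j < K.+2 | j != i.+1) (c - 1 - x j).
  by rewrite -px; apply: eq_bigr => j _; ring.
have eqinl (j : 'I_K.+1) : (inl j != inl i :> 'I_K.+1 + 'I_K.+1) = (j != i) by [].
have eqinr (j : 'I_K.+1) : (inr j != inr i :> 'I_K.+1 + 'I_K.+1) = (j != i) by [].
(* The pole x_i + 1 contributes the factor x_i - (x_i + 1) = -1 here, which is the minus sign in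
   front of the second product; in [sep_r] the corresponding factor is 1. *)
have sep_l : \prod_(j < K.+1 | inl j != inl i :> 'I_K.+1 + 'I_K.+1) (x i.+1 - x j.+1) *
    \prod_(j < K.+1 | inr j != inl i :> 'I_K.+1 + 'I_K.+1) (x i.+1 - (x j.+1 + 1)) =
    - ((\prod_(1 <= j < K.+2 | j != i.+1) (x i.+1 - x j)) *
      \prod_(1 <= j < K.+2 | j != i.+1) (x i.+1 - 1 - x j)).
  rewrite [X in _ * X](bigD1 i) //=.
  rewrite (eq_bigl _ _ eqinl) px [X in _ * (_ * X) = _](eq_bigl (fun j => j != i)) // px1.
  by ring.
have sep_r : \prod_(j < K.+1 | inl j != inr i :> 'I_K.+1 + 'I_K.+1) (x i.+1 + 1 - x j.+1) *
    \prod_(j < K.+1 | inr j != inr i :> 'I_K.+1 + 'I_K.+1) (x i.+1 + 1 - (x j.+1 + 1)) =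
    (\prod_(1 <= j < K.+2 | j != i.+1) (x i.+1 + 1 - x j)) *
      \prod_(1 <= j < K.+2 | j != i.+1) (x i.+1 - x j).
  rewrite [X in X * _](bigD1 i) //=.
  rewrite (eq_bigl _ _ eqinr) px1 [X in (_ * X) * _ = _](eq_bigl (fun j => j != i)) // px.
  by rewrite addrK -addrA addrCA subrr addr0 mul1r.
have pzy c : \prod_(j < K.+1) (c - (if (j < K)%N then z j.+1 else y K.+2 + 1)) *
    \prod_(j < K.+1) (c - (y j.+1 + 1))
   = (\prod_(1 <= j < K.+1) (c - z j)) * \prod_(1 <= j < K.+3) (c - 1 - y j).
  by rewrite pz -py; ring.
rewrite sep_l sep_r !pzy.
rewrite addrK !invrN !invfM.
by ring.
Qed.

(** * Gelfand-Tsetlin coefficients under two successive moves *)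

Section GTArrays.
Variable R : realType.
Local Notation C := R[i].
Implicit Types (v w u : arr R) (k l i j : nat).

Lemma coef_eE v k i : coef_e v k i =
  (\prod_(1 <= j < k.+2) (v k i - v k.+1 j))
    / \prod_(1 <= j < k.+1 | j != i) (v k i - v k j).
Proof. by rewrite /coef_e; case: eqP => // ->; rewrite invr0 mulr0. Qed.

Lemma coef_fE v k i : coef_f v k i =
  (\prod_(1 <= j < k) (v k i - v k.-1 j))
    / \prod_(1 <= j < k.+1 | j != i) (v k i - v k j).
Proof. by rewrite /coef_f; case: eqP => // ->; rewrite invr0 mulr0. Qed.

Lemma arr_subD w d d' : arr_add (arr_sub w d) d' = arr_sub (arr_add w d') d.
Proof. by apply: funext => j; apply: funext => i; rewrite /arr_add /arr_sub; ring. Qed.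

Lemma arr_subK w d : arr_add (arr_sub w d) d = w.
Proof. by apply: funext => j; apply: funext => i; rewrite /arr_add /arr_sub subrK. Qed.

Lemma arr_addK w d : arr_sub (arr_add w d) d = w.
Proof. by apply: funext => j; apply: funext => i; rewrite /arr_add /arr_sub addrK. Qed.

Lemma coef_e_congr v w k i : v k =1 w k -> v k.+1 =1 w k.+1 ->
  coef_e v k i = coef_e w k i.
Proof. by move=> /funext e1 /funext e2; rewrite /coef_e e1 e2. Qed.

Lemma coef_f_congr v w k i : v k =1 w k -> v k.-1 =1 w k.-1 ->
  coef_f v k i = coef_f w k i.
Proof. by move=> /funext e1 /funext e2; rewrite /coef_f e1 e2. Qed.

Lemma arr_add_row w k i l : l != k -> arr_add w (delta R k i) l =1 w l.
Proof. by move=> /negbTE e j; rewrite /arr_add /delta e addr0. Qed.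

Lemma arr_sub_row w k i l : l != k -> arr_sub w (delta R k i) l =1 w l.
Proof. by move=> /negbTE e j; rewrite /arr_sub /delta e subr0. Qed.

Lemma big_natD1 (F : nat -> C) (P : pred nat) a b i : (a <= i < b)%N -> P i ->
  \prod_(a <= j < b | P j) F j = F i * \prod_(a <= j < b | P j && (j != i)) F j.
Proof.
move=> ib Pi; rewrite -big_filter (bigD1_seq i) /=; first last.
- by rewrite filter_uniq // iota_uniq.
- by rewrite mem_filter Pi mem_index_iota.
by rewrite big_filter_cond.
Qed.

(** The moves interact only if l = k, through denominators, or l = k + 1, through numerators. In
    both cases the two factors containing both entries change sign simultaneously and all other
    factors agree. *)
Lemma coef_comm w k i l j : (1 <= i <= k)%N -> (1 <= j <= l)%N ->
  (k, i) != (l, j) ->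
  coef_e (arr_sub w (delta R k i)) k i
    * coef_f (arr_sub (arr_add w (delta R l j)) (delta R k i)) l j
  = coef_f (arr_add w (delta R l j)) l j
    * coef_e (arr_sub (arr_add w (delta R l j)) (delta R k i)) k i.
Proof.
move=> ik jl ne; rewrite xpair_eqE in ne.
have [lk|nlk] := eqVneq l k.
  move: lk ne jl => -> ; rewrite eqxx /= => ne jk.
  rewrite !coef_eE !coef_fE /arr_add /arr_sub /delta !eqxx !andbT /=.
  have eij : (i == j) = false by exact: negbTE.
  have eji : (j == i) = false by rewrite eq_sym.
  have k1 : (k.+1 == k) = false by lia.
  have k2 : (k.-1 == k) = false by lia.
  rewrite ?(eij, eji, k1, k2) /= ?(addr0, subr0).
  have den (c : C) (G : nat -> C) p q : (1 <= p <= k)%N -> (p == q) = false ->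
      \prod_(1 <= m < k.+1 | m != q) (c - G m) =
      (c - G p) * \prod_(1 <= m < k.+1 | (m != q) && (m != p)) (c - G m).
    by move=> pk pq; apply: big_natD1; [lia | rewrite pq].
  rewrite (den _ _ j i) // (den _ _ i j) // (den _ _ i j) // (den _ _ j i) //.
  have rest (c : C) (G : nat -> C) : (forall m, m != i -> m != j -> G m = w k m) ->
      \prod_(1 <= m < k.+1 | (m != i) && (m != j)) (c - G m) =
      \prod_(1 <= m < k.+1 | (m != i) && (m != j)) (c - w k m).
    by move=> Gw; apply: eq_bigr => m /andP[mi mj]; rewrite Gw.
  have rest' (c : C) (G : nat -> C) : (forall m, m != i -> m != j -> G m = w k m) ->
      \prod_(1 <= m < k.+1 | (m != j) && (m != i)) (c - G m) =
      \prod_(1 <= m < k.+1 | (m != i) && (m != j)) (c - w k m).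
    by move=> Gw; rewrite -(rest _ _ Gw); apply: eq_bigl => m; rewrite andbC.
  rewrite !rest ?rest'; first last.
  1-4: by move=> m /negbTE mi /negbTE mj; rewrite ?(mi, mj, addr0, subr0).
  have num (c : C) (G G' : nat -> C) p : G =1 G' ->
      \prod_(1 <= m < p) (c - G m) = \prod_(1 <= m < p) (c - G' m).
    by move=> GG'; apply: eq_bigr => m _; rewrite GG'.
  rewrite (num _ _ (w k.+1) _ (fun m => subr0 _)).
  rewrite (num _ _ (w k.-1) _ (fun m => etrans (subr0 _) (addr0 _))).
  rewrite (num _ _ (w k.-1) _ (fun m => addr0 _)).
  rewrite (num _ _ (w k.+1) _ (fun m => etrans (subr0 _) (addr0 _))).
  rewrite !eqxx eij eji !mulf_div; congr (_ / _); first by rewrite mulrC.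
  by rewrite /=; ring.
(* For l different from k and k + 1, each coefficient is independent of the entry moved by the other
   operator. *)
have [lk|nlk1] := eqVneq l k.+1; last first.
  have -> : coef_e (arr_sub (arr_add w (delta R l j)) (delta R k i)) k i =
            coef_e (arr_sub w (delta R k i)) k i.
    rewrite -arr_subD; apply: coef_e_congr; apply: arr_add_row; rewrite eq_sym //.
  rewrite mulrC; congr (_ * _); apply: coef_f_congr; apply: arr_sub_row => //.
  by apply: contra nlk1; lia.
rewrite {}lk in jl nlk {ne} *.
rewrite !coef_eE !coef_fE /arr_add /arr_sub /delta !eqxx (eq_sym k) (negbTE nlk) /=.
rewrite ?(addr0, subr0) !mulf_div; congr (_ / _); last first.
  by rewrite [RHS]mulrC; congr (_ * _); apply: eq_bigr => m _; rewrite ?(addr0, subr0).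
rewrite (big_natD1 _ (P := predT) (i := j)) //= ?eqxx.
rewrite [X in _ * X = _](big_natD1 _ (P := predT) (i := i)) //= ?eqxx.
rewrite [X in _ = X * _](big_natD1 _ (P := predT) (i := i)) //= ?eqxx.
rewrite [X in _ = _ * X](big_natD1 _ (P := predT) (i := j)) //= ?eqxx.
rewrite [X in _ * X * _](eq_bigr (fun m => w k i - 1 - w k.+1 m)); last first.
  by move=> m _; rewrite subr0.
rewrite [X in _ * (_ * X) = _](eq_bigr (fun m => w k.+1 j + 1 - w k m)); last first.
  by move=> m /negbTE->; rewrite subr0 addr0.
rewrite [X in _ = _ * X * _](eq_bigr (fun m => w k.+1 j + 1 - w k m)); last first.
  by move=> m _; rewrite addr0.
rewrite [X in _ = _ * (_ * X)](eq_bigr (fun m => w k i - 1 - w k.+1 m)); last first.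
  by move=> m /negbTE->; rewrite subr0 addr0.
by rewrite /=; ring.
Qed.

End GTArrays.

(** * Comparison of numbers by natural differences *)

Section NatLe.
Variable F : numDomainType.
Implicit Types x y z : F.

(** The negation covers both a negative integral difference and a non-integral one; this uniform
    treatment lets integral and non-integral pairs of entries share one set of inequalities. *)
Definition natle x y : Prop := exists t : nat, y = x + t%:R.

Lemma natle_refl x : natle x x.
Proof. by exists 0%N; rewrite addr0. Qed.

Lemma natle_trans y x z : natle x y -> natle y z -> natle x z.
Proof. by move=> [s ->] [t ->]; exists (s + t)%N; rewrite natrD addrA. Qed.

Lemma natleDr x y (t : nat) : natle x y -> natle x (y + t%:R).
Proof. by move=> xy; apply: natle_trans xy _; exists t. Qed.

Lemma natleBl x y (t : nat) : natle x y -> natle (x - t%:R) y.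
Proof. by apply: natle_trans; exists t; rewrite subrK. Qed.

Lemma natle_neq x y : natle x y -> x <> y -> natle (x + 1) y.
Proof.
move=> [[|t] ->]; first by rewrite addr0.
by move=> _; exists t; rewrite -natr1; ring.
Qed.

Lemma natle_succF x y : natle x y -> y + 1 <> x.
Proof.
move=> [t ->] /eqP; rewrite -addrA -subr_eq0 addrAC subrr add0r natr1.
by rewrite pnatr_eq0.
Qed.

End NatLe.

(** * The set of patterns and its behaviour under single moves *)

Section GTSet.
Variable R : realType.
Local Notation C := R[i].
Variable n : nat.
Variable a : nat -> C.
Implicit Types (v w u : arr R) (k l i j : nat).

(** Positions of an array, with row n + 1 as the fixed row. *)
Definition in_triangle k i := [&& 1 <= i, i <= k & k <= n.+1]%N.

(** Generalised interlacing: the last condition says v_{k,i} > v_{k+1,j} whenever the two entries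
    differ by an integer. For integral [a] these are the classical Gelfand-Tsetlin patterns in
    shifted form. *)
Definition GTset v : Prop :=
  [/\ forall k i, ~~ in_triangle k i -> v k i = 0,
      forall i, (1 <= i <= n.+1)%N -> v n.+1 i = a i,
      forall k i, (1 <= i <= k)%N -> (k <= n)%N -> natle (v k i) (v k.+1 i)
    & forall k i j, (1 <= i <= k)%N -> (k <= n)%N -> (i < j <= k.+1)%N ->
        ~ natle (v k i) (v k.+1 j)].

(** Chaining v_{k-1,i} to v_{k,i} and then to v_{k,j} would contradict the diagonal condition for
    rows k - 1 and k. *)
Lemma GTset_row v k i j : GTset v -> (1 <= i)%N -> (i < j <= k)%N -> (k <= n.+1)%N ->
  ~ natle (v k i) (v k j).
Proof.
move=> [_ _ vert diag] i1; case: k => [|k] ijk kn; first by lia.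
move=> h; apply: (diag k i j) => //; first by lia.
by apply: natle_trans h; apply: vert => //; lia.
Qed.

Lemma GTset_row_inj v k i j : GTset v -> (1 <= i <= k)%N -> (1 <= j <= k)%N ->
  (k <= n.+1)%N -> v k i = v k j -> i = j.
Proof.
move=> Sv ik jk kn e; case: (ltngtP i j) => // ij; exfalso.
- by apply: (@GTset_row v k i j) => //; [lia|lia|rewrite e; apply: natle_refl].
- by apply: (@GTset_row v k j i) => //; [lia|lia|rewrite e; apply: natle_refl].
Qed.

(** Verifies the pole condition of [GT_diagonal_identity]. The row condition forces i < l; if
    v_{k-1,i} were strictly below v_{k,i}, or v_{k,l} strictly below v_{k+1,l}, the room of one unit
    would violate a diagonal condition. *)
Lemma GTset_coalesce v k i l : GTset v -> (1 <= i <= k)%N -> (1 <= l <= k)%N ->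
  (k <= n)%N -> v k i = v k l + 1 ->
  [/\ (i < k)%N, v k i = v k.-1 i & v k l = v k.+1 l].
Proof.
move=> Sv ik lk kn e; have [_ _ vert diag] := Sv.
have il : (i < l)%N.
  rewrite ltnNge leq_eqVlt; apply/negP => /predU1P[li|li].
    by apply: (natle_succF (natle_refl (v k l))); rewrite -e li.
  apply: (@GTset_row v k l i) => //; [lia|lia|lia|].
  by rewrite e; exists 1%N.
have ik' : (i < k)%N by lia.
split=> //.
- apply: contrapT => ne; case: k ik lk kn e ne il ik' => [|k] //= ik lk kn e ne il ik'.
  have h : natle (v k i) (v k.+1 i) by apply: vert; lia.
  apply: (diag k i l) => //; try lia.
  have := natle_neq h (fun e => ne (esym e)); rewrite e => -[t h2].
  by exists t; apply: (addIr 1); rewrite h2; ring.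
- apply: contrapT => ne; apply: (diag k i l) => //; try lia.
  by rewrite e; apply: natle_neq => //; apply: vert; lia.
Qed.

Section TwoSteps.
Variables (v : arr R) (k i l j : nat).
Hypotheses (Sv : GTset v) (ki : (1 <= i <= k)%N) (kn : (k <= n)%N).
Hypotheses (lj : (1 <= j <= l)%N) (ln : (l <= n)%N) (ne : (k, i) != (l, j)).
Hypothesis Sw : GTset (arr_sub (arr_add v (delta R k i)) (delta R l j)).

(* An inequality broken by raising one entry can only be restored by lowering that
   same entry. *)
Lemma GTset_raise : GTset (arr_add v (delta R k i)).
Proof.
have [out top vert diag] := Sv; have [_ _ wvert wdiag] := Sw.
have := ne; rewrite xpair_eqE => ne'.
rewrite /arr_sub /arr_add /delta in wvert wdiag *.
split=> [k' i' t|i' i'n|k' i' ik' kn'|k' i' j' ik' kn' ij].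
- rewrite out //; suff -> : (k' == k) && (i' == i) = false by rewrite addr0.
  by apply/negP => /andP[/eqP e1 /eqP e2]; move: t; rewrite e1 e2 /in_triangle; lia.
- by rewrite top // (_ : (n.+1 == k) = false) ?addr0 //; lia.
- have := vert _ _ ik' kn'; have := wvert _ _ ik' kn'.
  have [/andP[/eqP -> /eqP ->]|_] := boolP ((k' == k) && (i' == i)); last first.
    by move=> _; rewrite addr0; apply: natleDr.
  have -> : (k.+1 == k) = false by lia.
  rewrite (negbTE ne') /= subr0 addr0 => h _.
  by rewrite -[v k.+1 i](subrK ((k.+1 == l) && (i == j))%:R); apply: natleDr.
- have := diag _ _ _ ik' kn' ij; have := wdiag _ _ _ ik' kn' ij.
  have [/andP[/eqP e1 /eqP ->]|_] := boolP ((k'.+1 == k) && (j' == i)); last first.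
    move=> _ h; rewrite addr0 => h'; apply: h.
    by apply: natle_trans h'; apply: natleDr; apply: natle_refl.
  rewrite e1; have -> : (k' == k) = false by lia.
  rewrite (negbTE ne') /= subr0 !addr0 => h _ h'; apply: h.
  exact: natleBl.
Qed.

Lemma GTset_lower : GTset (arr_sub v (delta R l j)).
Proof.
have [out top vert diag] := Sv; have [_ _ wvert wdiag] := Sw.
have := ne; rewrite xpair_eqE (eq_sym k) (eq_sym i) => ne'.
rewrite /arr_sub /arr_add /delta in wvert wdiag *.
split=> [k' i' t|i' i'n|k' i' ik' kn'|k' i' j' ik' kn' ij].
- rewrite out //; suff -> : (k' == l) && (i' == j) = false by rewrite subr0.
  by apply/negP => /andP[/eqP e1 /eqP e2]; move: t; rewrite e1 e2 /in_triangle; lia.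
- by rewrite top // (_ : (n.+1 == l) = false) ?subr0 //; lia.
- have := vert _ _ ik' kn'; have := wvert _ _ ik' kn'.
  have [/andP[/eqP e1 /eqP ->]|_] := boolP ((k'.+1 == l) && (i' == j)); last first.
    by move=> _; rewrite subr0; apply: natleBl.
  rewrite e1; have -> : (k' == l) = false by lia.
  rewrite (negbTE ne') /= subr0 addr0 => h _; rewrite subr0; apply: natle_trans h.
  exact/natleDr/natle_refl.
- have := diag _ _ _ ik' kn' ij; have := wdiag _ _ _ ik' kn' ij.
  have [/andP[/eqP -> /eqP ->]|_] := boolP ((k' == l) && (i' == j)); last first.
    move=> _ h; rewrite subr0 => h'; apply: h.
    by rewrite -[v k'.+1 j'](subrK ((k'.+1 == l) && (j' == j))%:R); apply: natleDr.
  have -> : (l.+1 == l) = false by lia.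
  rewrite (negbTE ne') /= subr0 addr0 subr0 => h _ h'; apply: h.
  exact: natleDr.
Qed.

End TwoSteps.

Lemma natle_pred (x y : C) : natle (x - 1) y -> y <> x - 1 -> natle x y.
Proof.
by move=> h ne; have := natle_neq h (fun e => ne (esym e)); rewrite subrK.
Qed.

(** Only the relations of v_{k,i} to v_{k-1,i} and to v_{k+1,j} with j > i can break. The excluded
    boundary cases are zeros of the numerator of [coef_f v k i] and of [coef_e] at the lowered
    array. *)
Lemma GTset_lower1 v k i : GTset v -> (1 <= i <= k)%N -> (k <= n)%N ->
  ((i < k)%N -> v k i <> v k.-1 i) ->
  (forall j, (i < j <= k.+1)%N -> v k.+1 j <> v k i - 1) ->
  GTset (arr_sub v (delta R k i)).
Proof.
move=> [out top vert diag] ik kn nz ny.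
rewrite /arr_sub /delta.
split=> [k' i' t|i' i'n|k' i' ik' kn'|k' i' j' ik' kn' ij].
- rewrite out //; suff -> : (k' == k) && (i' == i) = false by rewrite subr0.
  by apply/negP => /andP[/eqP e1 /eqP e2]; move: t; rewrite e1 e2 /in_triangle; lia.
- by rewrite top // (_ : (n.+1 == k) = false) ?subr0 //; lia.
- have := vert _ _ ik' kn'.
  have [/andP[/eqP e1 /eqP e2]|_] := boolP ((k'.+1 == k) && (i' == i)); last first.
    by rewrite subr0; apply: natleBl.
  rewrite e1 e2 (_ : (k' == k) = false) ?subr0; last by lia.
  move=> h; have [|t ->] := natle_neq h.
    by move=> e; apply: nz; [lia|rewrite -e -e1].
  by exists t; rewrite /=; ring.
- have [/andP[/eqP e1 /eqP e2]|_] := boolP ((k' == k) && (i' == i)).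
    rewrite e1 e2 (_ : (k.+1 == k) = false) ?subr0; last by lia.
    move=> /natle_pred h; apply: (diag k i j'); [lia|lia|lia|].
    by apply: h; apply: ny; lia.
  rewrite subr0 => h; apply: (diag k' i' j') => //.
  by rewrite -[v k'.+1 j'](subrK ((k'.+1 == k) && (j' == i))%:R); apply: natleDr.
Qed.

(** The mirror image of lowering: the boundary cases are zeros of the numerator of [coef_e v k i]
    and of [coef_f] at the raised array. *)
Lemma GTset_raise1 v k i : GTset v -> (1 <= i <= k)%N -> (k <= n)%N ->
  v k i <> v k.+1 i ->
  (forall j, (1 <= j < i)%N -> v k.-1 j <> v k i + 1) ->
  GTset (arr_add v (delta R k i)).
Proof.
move=> [out top vert diag] ik kn ny nz.
rewrite /arr_add /delta.
split=> [k' i' t|i' i'n|k' i' ik' kn'|k' i' j' ik' kn' ij].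
- rewrite out //; suff -> : (k' == k) && (i' == i) = false by rewrite addr0.
  by apply/negP => /andP[/eqP e1 /eqP e2]; move: t; rewrite e1 e2 /in_triangle; lia.
- by rewrite top // (_ : (n.+1 == k) = false) ?addr0 //; lia.
- have := vert _ _ ik' kn'.
  have [/andP[/eqP e1 /eqP e2]|_] := boolP ((k' == k) && (i' == i)); last first.
    by rewrite addr0; apply: natleDr.
  rewrite e1 e2 (_ : (k.+1 == k) = false) ?addr0; last by lia.
  by move=> h; apply: natle_neq.
- have [/andP[/eqP e1 /eqP e2]|_] := boolP ((k'.+1 == k) && (j' == i)).
    rewrite e1 e2 (_ : (k' == k) = false) ?addr0; last by lia.
    rewrite -[v k' i'](addrK 1) => /natle_pred h.
    have {}h : natle (v k' i' + 1) (v k i + 1).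
      by apply: h; rewrite addrK => e; apply: (nz i'); [lia|rewrite e -e1].
    apply: (diag k' i' j') => //; rewrite e1 e2; case: h => t h; exists t.
    by apply: (addIr 1); rewrite h; ring.
  rewrite addr0 => h; apply: (diag k' i' j') => //.
  by apply: natle_trans h; apply: natleDr; apply: natle_refl.
Qed.

Lemma coef_e_sub v k i : coef_e (arr_sub v (delta R k i)) k i =
  (\prod_(1 <= j < k.+2) (v k i - 1 - v k.+1 j))
    / \prod_(1 <= j < k.+1 | j != i) (v k i - 1 - v k j).
Proof.
rewrite coef_eE /arr_sub /delta !eqxx /= (_ : (k.+1 == k) = false); last by lia.
by congr (_ / _); apply: eq_bigr => j; [|move/negbTE->]; rewrite subr0.
Qed.

Lemma coef_f_add v k i : (1 <= k)%N -> coef_f (arr_add v (delta R k i)) k i =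
  (\prod_(1 <= j < k) (v k i + 1 - v k.-1 j))
    / \prod_(1 <= j < k.+1 | j != i) (v k i + 1 - v k j).
Proof.
move=> k1.
rewrite coef_fE /arr_add /delta !eqxx /= (_ : (k.-1 == k) = false); last by lia.
by congr (_ / _); apply: eq_bigr => j; [|move/negbTE->]; rewrite addr0.
Qed.

Lemma prod_nat_eq0 (F : nat -> C) p q j :
  (p <= j < q)%N -> F j = 0 -> \prod_(p <= m < q) F m = 0.
Proof. by move=> jr Fj; rewrite (big_natD1 _ (P := predT) jr) // Fj mul0r. Qed.

(** A step out of the set and back has coefficient 0, so restricting the operators to the set does
    not disturb the sum over all i in the diagonal identity. *)
Lemma leave_lower v k i : GTset v -> (1 <= i <= k)%N -> (k <= n)%N ->
  ~ GTset (arr_sub v (delta R k i)) ->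
  coef_e (arr_sub v (delta R k i)) k i * coef_f v k i = 0.
Proof.
move=> Sv ik kn nS; apply: contrapT => ne; apply: nS.
apply: GTset_lower1 => // [ik' e|j ij e]; apply: ne.
- rewrite coef_fE (prod_nat_eq0 (j := i)) ?mul0r ?mulr0 //; last by rewrite e subrr.
  by lia.
- rewrite coef_e_sub (prod_nat_eq0 (j := j)) ?mul0r //; last by rewrite e subrr.
  by lia.
Qed.

Lemma leave_raise v k i : GTset v -> (1 <= i <= k)%N -> (k <= n)%N ->
  ~ GTset (arr_add v (delta R k i)) ->
  coef_f (arr_add v (delta R k i)) k i * coef_e v k i = 0.
Proof.
move=> Sv ik kn nS; apply: contrapT => ne; apply: nS.
apply: GTset_raise1 => // [e|j ij e]; apply: ne.
- rewrite coef_eE (prod_nat_eq0 (j := i)) ?mul0r ?mulr0 //; last by rewrite e subrr.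
  by lia.
- rewrite coef_f_add ?(prod_nat_eq0 (j := j)) ?mul0r //; [lia|by rewrite e subrr|lia].
Qed.

(** * Operators on coordinate functions and their commutators *)

Definition GTe1 k i (phi : arr R -> C) w :=
  if `[< GTset w >] then
    - coef_e (arr_sub w (delta R k i)) k i * phi (arr_sub w (delta R k i)) else 0.
Definition GTf1 k i (phi : arr R -> C) w :=
  if `[< GTset w >] then
    coef_f (arr_add w (delta R k i)) k i * phi (arr_add w (delta R k i)) else 0.
(* The Gelfand-Tsetlin formulas transposed to coordinate functions: if [phi] lists the
   coordinates of a vector in the basis T(v), then [GTe k phi] and [GTf k phi] list those
   of its images under e_k and f_k. *)
Definition GTe k phi w := \sum_(1 <= i < k.+1) GTe1 k i phi w.
Definition GTf k phi w := \sum_(1 <= i < k.+1) GTf1 k i phi w.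

Definition supported (phi : arr R -> C) := forall v, ~ GTset v -> phi v = 0.

Lemma GTe1_sum k i p q (F : nat -> arr R -> C) w :
  GTe1 k i (fun u => \sum_(p <= m < q) F m u) w = \sum_(p <= m < q) GTe1 k i (F m) w.
Proof. by rewrite /GTe1; case: ifP => _; rewrite ?mulr_sumr // big1. Qed.

Lemma GTf1_sum k i p q (F : nat -> arr R -> C) w :
  GTf1 k i (fun u => \sum_(p <= m < q) F m u) w = \sum_(p <= m < q) GTf1 k i (F m) w.
Proof. by rewrite /GTf1; case: ifP => _; rewrite ?mulr_sumr // big1. Qed.

(** The coefficients agree by [coef_comm]. What remains is that both orders of the moves are
    possible as soon as the common end point is a pattern. *)
Lemma GTe1_GTf1 phi k i l j w : supported phi ->
  (1 <= i <= k)%N -> (k <= n)%N -> (1 <= j <= l)%N -> (l <= n)%N ->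
  (k, i) != (l, j) -> GTe1 k i (GTf1 l j phi) w = GTf1 l j (GTe1 k i phi) w.
Proof.
move=> sphi ik kn jl ln ne; rewrite /GTe1 /GTf1.
case: asboolP => // Sw; rewrite arr_subD.
set u := arr_sub (arr_add _ _) _.
(* Either both sides vanish, or the end point [u] lies in the set and with it the two intermediate
   arrays. *)
have [phi0|phiu] := eqVneq (phi u) 0; first by rewrite phi0 !mulr0 !if_same !mulr0.
have Su : GTset u by apply: contrapT => /sphi /eqP; rewrite (negbTE phiu).
rewrite asboolT; last by apply: (@GTset_lower w l j k i); rewrite // eq_sym.
rewrite asboolT; last by apply: (@GTset_raise w l j k i); rewrite // eq_sym.
by rewrite !mulrA !(mulNr, mulrN) coef_comm.
Qed.

Lemma GT_diagonal phi k w : supported phi -> (1 <= k <= n)%N -> GTset w ->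
  \sum_(1 <= i < k.+1) (GTe1 k i (GTf1 k i phi) w - GTf1 k i (GTe1 k i phi) w)
  = coef_h w k * phi w.
Proof.
move=> sphi kn Sw.
rewrite /coef_h -(@GT_diagonal_identity _ k (w k) (w k.+1) (w k.-1)); first last.
- by move=> i l ik lk; apply: GTset_coalesce => //; lia.
- by move=> i l ik lk; apply: GTset_row_inj => //; lia.
- by lia.
rewrite mulr_suml !big_nat; apply: eq_bigr => i ik.
rewrite /GTe1 /GTf1 asboolT // arr_subK arr_addK.
have -> : forall b : bool, - coef_e (arr_sub w (delta R k i)) k i *
    (if b then coef_f w k i * phi w else 0) =
    - (if b then coef_e (arr_sub w (delta R k i)) k i * coef_f w k i else 0) * phi w.
  by case; rewrite ?(mulr0, oppr0, mul0r) // !mulNr mulrA.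
have -> : forall b : bool, coef_f (arr_add w (delta R k i)) k i *
    (if b then - coef_e w k i * phi w else 0) =
    - (if b then coef_f (arr_add w (delta R k i)) k i * coef_e w k i else 0) * phi w.
  by case; rewrite ?(mulr0, oppr0, mul0r) // !mulNr mulrN mulrA.
(* Terms passing through arrays outside the set are 0 by [leave_lower] and [leave_raise], so the
   membership tests may be removed before the identity is applied. *)
have ifK (b : bool) (c : C) : (~ b -> c = 0) -> (if b then c else 0) = c.
  by case: b => // ->.
rewrite ifK; last first.
  by move=> nS; apply: leave_lower => //; [lia|move=> S'; apply/nS/asboolP].
rewrite ifK; last first.
  by move=> nS; apply: leave_raise => //; [lia|move=> S'; apply/nS/asboolP].
rewrite coef_f_add ?coef_e_sub ?coef_eE ?coef_fE; last by lia.
by ring.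
Qed.

Lemma GTe_GTf phi k l w : supported phi -> (1 <= k <= n)%N -> (1 <= l <= n)%N ->
  GTe k (GTf l phi) w - GTf l (GTe k phi) w = if k == l then coef_h w k * phi w else 0.
Proof.
move=> sphi kn ln; case: (pselect (GTset w)) => [Sw|nSw]; last first.
  rewrite sphi // mulr0 if_same /GTe /GTf !big1 ?subrr // => i _.
  - by rewrite /GTf1 asboolF.
  - by rewrite /GTe1 asboolF.
rewrite /GTe /GTf.
under eq_bigr => i _ do rewrite GTe1_sum.
under [X in _ - X]eq_bigr => i _ do rewrite GTf1_sum.
rewrite [X in _ - X]exchange_big -sumrB /=.
have [<-|kl] := eqVneq k l; last first.
  rewrite big_nat big1 // => i ik; rewrite -sumrB big_nat big1 // => j jl.
  have ne : (k, i) != (l, j) by rewrite xpair_eqE (negbTE kl).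
  by rewrite GTe1_GTf1 ?subrr //; lia.
rewrite -GT_diagonal // !big_nat; apply: eq_bigr => i ik.
rewrite -sumrB (bigD1_seq i) /= ?mem_index_iota ?iota_uniq //.
rewrite [X in _ + X]big1_seq ?addr0 // => j /andP[ji]; rewrite mem_index_iota => jk.
have ne : (k, i) != (k, j) by rewrite xpair_eqE eqxx eq_sym.
by rewrite GTe1_GTf1 ?subrr //; lia.
Qed.

Definition cartan_entry k l : C := 2 * (k == l)%:R - (k == l.+1)%:R - (k.+1 == l)%:R.

Lemma coef_h_add w k l j : (1 <= j <= l)%N -> (1 <= k)%N ->
  coef_h (arr_add w (delta R l j)) k = coef_h w k + cartan_entry k l.
Proof.
move=> jl k1.
have sumD m : \sum_(1 <= i < m.+1) arr_add w (delta R l j) m i =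
    \sum_(1 <= i < m.+1) w m i + (m == l)%:R.
  rewrite /arr_add big_split /=; congr (_ + _); rewrite /delta.
  have [->|_] := eqVneq m l; last by rewrite big1.
  rewrite (bigD1_seq j) /= ?mem_index_iota ?iota_uniq //.
  by rewrite eqxx big1 ?addr0 // => i /negbTE ->.
rewrite /coef_h -[in RHS](prednK k1) -[in LHS](prednK k1) /= !sumD /cartan_entry /=.
by rewrite eqSS; ring.
Qed.

(** The bracket relation of h_k and f_l, where h_k multiplies by [coef_h]: raising an entry of row l
    shifts this eigenvalue by the Cartan integer. *)
Lemma GTf_weight phi k l w : (1 <= k)%N -> (1 <= l)%N ->
  coef_h w k * GTf l phi w =
  GTf l (fun u => coef_h u k * phi u) w - cartan_entry k l * GTf l phi w.
Proof.
move=> k1 l1; rewrite /GTf !mulr_sumr -sumrB !big_nat; apply: eq_bigr => j jl.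
rewrite /GTf1; case: ifP => _; rewrite ?mulr0 ?subrr // coef_h_add //.
by ring.
Qed.

Lemma GTe_supported phi k : supported (GTe k phi).
Proof. by move=> v nS; rewrite /GTe big1 // => i _; rewrite /GTe1 asboolF. Qed.

Lemma GTf_supported phi k : supported (GTf k phi).
Proof. by move=> v nS; rewrite /GTf big1 // => i _; rewrite /GTf1 asboolF. Qed.

(** Coordinates of T(u). For [u] outside the set this is the zero function, in accordance with T(u)
    = 0. *)
Definition GTbasis u w : C := `[< GTset u /\ w = u >]%:R.

Lemma GTbasis_supported u : supported (GTbasis u).
Proof. by move=> v nS; rewrite /GTbasis asboolF // => -[Su vu]; apply: nS; rewrite vu. Qed.

Lemma GTbasis_out u w : ~ GTset u -> GTbasis u w = 0.
Proof. by move=> nS; rewrite /GTbasis asboolF // => -[]. Qed.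

Lemma GTbasisE u : GTset u -> GTbasis u u = 1.
Proof. by move=> Su; rewrite /GTbasis asboolT. Qed.

Lemma GTbasis_neq0 u w : GTbasis u w <> 0 -> GTset u /\ w = u.
Proof. by rewrite /GTbasis; case: asboolP. Qed.

Lemma GTe1_basis k i v w : GTset v ->
  GTe1 k i (GTbasis v) w = - coef_e v k i * GTbasis (arr_add v (delta R k i)) w.
Proof.
move=> Sv; rewrite /GTe1 /GTbasis.
have [->|ne] := pselect (w = arr_add v (delta R k i)).
  rewrite arr_addK [X in if _ then _ * (nat_of_bool X)%:R else _]asboolT // mulr1.
  case: asboolP => Sw; last by rewrite asboolF ?mulr0 // => -[].
  by rewrite asboolT ?mulr1.
rewrite [X in if _ then _ * (nat_of_bool X)%:R else _]asboolF; last first.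
  by move=> [_ e]; apply: ne; rewrite -e arr_subK.
by rewrite [X in _ = _ * (nat_of_bool X)%:R]asboolF ?mulr0 ?if_same // => -[].
Qed.

Lemma GTf1_basis k i v w : GTset v ->
  GTf1 k i (GTbasis v) w = coef_f v k i * GTbasis (arr_sub v (delta R k i)) w.
Proof.
move=> Sv; rewrite /GTf1 /GTbasis.
have [->|ne] := pselect (w = arr_sub v (delta R k i)).
  rewrite arr_subK [X in if _ then _ * (nat_of_bool X)%:R else _]asboolT // mulr1.
  case: asboolP => Sw; last by rewrite asboolF ?mulr0 // => -[].
  by rewrite asboolT ?mulr1.
rewrite [X in if _ then _ * (nat_of_bool X)%:R else _]asboolF; last first.
  by move=> [_ e]; apply: ne; rewrite -e arr_addK.
by rewrite [X in _ = _ * (nat_of_bool X)%:R]asboolF ?mulr0 ?if_same // => -[].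
Qed.

(** A vanishing factor would identify v_{k,i} with some v_{k+1,j}: the diagonal conditions exclude
    this for j other than i, the hypothesis for j = i. The denominator is nonzero because rows have
    distinct entries. *)
Lemma coef_e_neq0 v k i : GTset v -> (1 <= i <= k)%N -> (k <= n)%N ->
  v k i <> v k.+1 i -> coef_e v k i != 0.
Proof.
move=> Sv ik kn ne; have [_ _ vert diag] := Sv.
rewrite coef_eE mulf_neq0 ?invr_eq0 // prodf_seq_neq0; apply/allP => j;
  rewrite mem_index_iota => jk; apply/implyP => ji; rewrite subr_eq0; apply/eqP => e.
- case: (ltngtP i j) => ij; last by apply: ne; rewrite e ij.
    by apply: (diag k i j); [lia|lia|lia|rewrite e; apply: natle_refl].
  case: k ik kn ne jk e => [|k] ik kn ne jk e; first by lia.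
  apply: (diag k j i); [lia|lia|lia|rewrite e].
  by apply: (@natle_trans _ (v k.+1 j)); apply: vert; lia.
- by case/negP: ji; apply/eqP/esym; apply: (GTset_row_inj Sv _ _ _ e) => //; lia.
Qed.

Lemma coef_f_neq0 v k i : GTset v -> GTset (arr_sub v (delta R k i)) ->
  (1 <= i <= k)%N -> (k <= n)%N -> coef_f v k i != 0.
Proof.
move=> Sv [_ _ uvert _] ik kn; have [_ _ vert diag] := Sv.
rewrite coef_fE mulf_neq0 ?invr_eq0 // prodf_seq_neq0; apply/allP => j;
  rewrite mem_index_iota => jk; apply/implyP => ji; rewrite subr_eq0; apply/eqP => e.
- case: k ik kn jk e uvert => [|k] ik kn jk e uvert; first by lia.
  case: (ltngtP i j) => ij.
  + apply: (GTset_row Sv (k := k.+1) (i := i) (j := j)); [lia|lia|lia|].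
    by rewrite e; apply: vert; lia.
  + by apply: (diag k j i); [lia|lia|lia|rewrite e; apply: natle_refl].
  + have := uvert k i; rewrite /arr_sub /delta !eqxx /= (_ : (k == k.+1) = false); last by lia.
    rewrite subr0 => h; have {}h := h ltac:(lia) ltac:(lia).
    by apply: (natle_succF h); rewrite subrK e ij.
- by case/negP: ji; apply/eqP/esym; apply: (GTset_row_inj Sv _ _ _ e) => //; lia.
Qed.

(** * Aligned rows: singular vectors and generation from the top array *)

(** Rows 1, ..., m are truncations of row m. *)
Definition aligned m v := forall k i, (1 <= i <= k)%N -> (k < m)%N -> v k i = v k.+1 i.

(** The only obstruction is v_{k-1,j} = v_{k,i} + 1 with j < i. By alignment this value is v_{k,j},
    and then v_{k+1,i} would exceed it by a natural number, against the diagonal condition. *)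
Lemma aligned_raise v k i : GTset v -> aligned k v -> (1 <= i <= k)%N -> (k <= n)%N ->
  v k i <> v k.+1 i -> GTset (arr_add v (delta R k i)).
Proof.
move=> Sv al ik kn ne; have [_ _ vert diag] := Sv.
apply: GTset_raise1 => // j ji e.
apply: (diag k j i); [lia|lia|lia|].
have := al k.-1 j; rewrite prednK; last by lia.
move=> h; rewrite -h ?e; [|lia|lia].
by apply: natle_neq => //; apply: vert.
Qed.

(** At least one of i, j is at most k - 1, and in that column row k has changed while row k - 1 has
    not. This makes the operators triangular with respect to alignment. *)
Lemma aligned_swap v k i j : aligned k v -> (1 <= i <= k)%N -> (1 <= j <= k)%N ->
  j <> i -> ~ aligned k (arr_sub (arr_add v (delta R k i)) (delta R k j)).
Proof.
move=> al ik jk ji; case: k al ik jk => [|k] al ik jk al'; first by lia.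
have step m : (1 <= m <= k)%N -> (m == i)%:R - (m == j)%:R = 0 :> C.
  move=> mk; have := al' k m mk (ltnSn k).
  rewrite /arr_sub /arr_add /delta eqxx (_ : (k == k.+1) = false); last by lia.
  rewrite addr0 subr0 -(al k m mk (ltnSn k)) /= -addrA => /esym/eqP.
  by rewrite addrC -subr_eq0 addrK => /eqP.
have [jk'|kj] := leqP j k.
  have := step j; rewrite eqxx (_ : (j == i) = false) ?sub0r; last by lia.
  by move=> /(_ ltac:(lia))/eqP; rewrite oppr_eq0 oner_eq0.
have := step i; rewrite eqxx (_ : (i == j) = false) ?subr0; last by lia.
by move=> /(_ ltac:(lia))/eqP; rewrite oner_eq0.
Qed.

Definition top_arr : arr R := fun k i => if in_triangle k i then a i else 0.

Lemma aligned_top v : GTset v -> aligned n.+1 v -> v = top_arr.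
Proof.
move=> [out top _ _] al; apply: funext => k; apply: funext => i; rewrite /top_arr.
case: ifPn => [|/out //]; rewrite /in_triangle => /and3P[i1 ik kn].
rewrite -(top i); last by lia.
have : forall d, (k + d <= n.+1)%N -> v k i = v (k + d)%N i.
  elim=> [|d IHd] kd; first by rewrite addn0.
  by rewrite IHd ?addnS; [apply: al; lia|lia].
by move=> /(_ (n.+1 - k)%N); rewrite subnKC // => ->.
Qed.

Hypothesis a_regular : forall i j, (1 <= i < j)%N -> (j <= n.+1)%N -> ~ natle (a i) (a j).

Lemma top_GTset : GTset top_arr.
Proof.
split=> [k i /negbTE t|i i1|k i ik kn|k i j ik kn ij]; rewrite /top_arr /in_triangle.
- by rewrite -/(in_triangle k i) t.
- by rewrite (_ : [&& _, _ & _] = true) //; lia.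
- rewrite (_ : [&& _, _ & _] = true); last by lia.
  rewrite (_ : [&& _, _ & _] = true); last by lia.
  exact: natle_refl.
- rewrite (_ : [&& _, _ & _] = true); last by lia.
  rewrite (_ : [&& _, _ & _] = true); last by lia.
  by apply: a_regular; lia.
Qed.

Lemma top_raise_out k i : (1 <= i <= k)%N -> (k <= n)%N ->
  ~ GTset (arr_add top_arr (delta R k i)).
Proof.
move=> ik kn [_ _ vert _]; have := vert k i ik kn.
rewrite /arr_add /delta !eqxx (_ : (k.+1 == k) = false); last by lia.
rewrite /top_arr /in_triangle (_ : [&& _, _ & _] = true); last by lia.
rewrite (_ : [&& _, _ & _] = true); last by lia.
by rewrite addr0 => /natle_succF; apply.
Qed.

(** Induction on m: being killed by e_m upgrades alignment of the support from m rows to m + 1 rows,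
    and a fully aligned pattern is [top_arr]. *)
Lemma GTe_singular phi : supported phi ->
  (forall k w, (1 <= k <= n)%N -> GTe k phi w = 0) ->
  forall v, phi v <> 0 -> v = top_arr.
Proof.
move=> sphi sing v phiv.
have Sphi u : phi u <> 0 -> GTset u by move=> h; apply: contrapT => /sphi.
suff al m : (m <= n.+1)%N -> forall u, phi u <> 0 -> aligned m u.
  by apply: aligned_top; [apply: Sphi|apply: (al n.+1)].
elim: m => [|m IHm] mn u phiu k i ik km; first by [].
have al := IHm (ltnW mn).
case: (ltngtP k m) => [lt|gt|km']; [by apply: al|by lia|].
move: km' ik {km} => -> im; apply: contrapT => ne.
have Sw : GTset (arr_add u (delta R m i)).
  by apply: aligned_raise => //; [apply: Sphi|apply: al].
(* At the array u + delta^{m,i} all other contributions to e_m phi come from arrays that are not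
   aligned up to row m, hence lie outside the support; the term of [u] has a nonzero coefficient. *)
have := sing m (arr_add u (delta R m i)) ltac:(lia).
rewrite /GTe (bigD1_seq i) /= ?mem_index_iota ?iota_uniq //.
rewrite [X in _ + X]big1_seq ?addr0; last first.
  move=> j /andP[ji]; rewrite mem_index_iota => jm; rewrite /GTe1 asboolT //.
  rewrite [X in _ * X](_ : _ = 0) ?mulr0 //; apply: contrapT => h.
  by apply: (aligned_swap (al _ phiu) im jm _ (al _ h)); apply/eqP.
rewrite /GTe1 asboolT // arr_addK => /eqP.
rewrite mulf_eq0 oppr_eq0 (negbTE (coef_e_neq0 _ _ _ ne)) //=; last exact: Sphi.
by move=> /eqP.
Qed.

(** The depth below [top_arr]: it is 0 there and grows by 1 with each lowering move. *)
Definition height v : C := \sum_(1 <= k < n.+1) \sum_(1 <= i < k.+1) (a i - v k i).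

Lemma height_add v k i : (1 <= i <= k)%N -> (k <= n)%N ->
  height (arr_add v (delta R k i)) = height v - 1.
Proof.
move=> ik kn; rewrite /height.
transitivity (\sum_(1 <= k' < n.+1) (\sum_(1 <= i' < k'.+1) (a i' - v k' i')
   - \sum_(1 <= i' < k'.+1) delta R k i k' i')).
  by apply: eq_bigr => k' _; rewrite -sumrB; apply: eq_bigr => i' _; rewrite /arr_add; ring.
rewrite sumrB; congr (_ - _).
rewrite (bigD1_seq k) /= ?mem_index_iota ?iota_uniq //; last by lia.
rewrite (bigD1_seq i) /= ?mem_index_iota ?iota_uniq //.
rewrite /delta !eqxx big1 ?big1 ?addr0 // => [k' /negbTE ->|i' /negbTE ->] //.
by rewrite big1.
Qed.

Lemma height_nat v : GTset v -> exists t : nat, height v = t%:R.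
Proof.
move=> [_ top vert _].
have nat_sum (p q : nat) (F : nat -> C) :
    (forall m, (p <= m < q)%N -> exists t : nat, F m = t%:R) ->
    exists t : nat, \sum_(p <= m < q) F m = t%:R.
  move=> Fn; rewrite big_nat; apply: (big_ind (fun x : C => exists t : nat, x = t%:R)).
  - by exists 0%N.
  - by move=> _ _ [s ->] [t ->]; exists (s + t)%N; rewrite natrD.
  - exact: Fn.
apply: (nat_sum) => k kn; apply: (nat_sum) => i ik.
suff : forall d, (k + d <= n.+1)%N -> natle (v k i) (v (k + d)%N i).
  move=> /(_ (n.+1 - k)%N); rewrite subnKC; last by lia.
  move=> /(_ (leqnn _))[t e]; exists t; rewrite -(top i); last by lia.
  by rewrite e; ring.
elim=> [|d IHd] kd; first by rewrite addn0; apply: natle_refl.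
by rewrite addnS; apply: natle_trans (IHd _) (vert _ _ _ _); lia.
Qed.

Lemma natr_pred (x : C) (s t : nat) : x = s%:R -> x - 1 = t%:R -> s = t.+1.
Proof.
move=> -> e; apply/eqP; rewrite -(eqr_nat C) -natr1 -e; apply/eqP; by ring.
Qed.

Definition height_bounded (L : nat) (phi : arr R -> C) :=
  forall v, phi v <> 0 -> exists2 t : nat, (t < L)%N & height v = t%:R.

Lemma GTe_height L phi k : (1 <= k <= n)%N ->
  height_bounded L.+1 phi -> height_bounded L (GTe k phi).
Proof.
move=> kn hb w ne.
have Sw : GTset w by apply: contrapT => /(@GTe_supported phi k).
have [i ik phii] : exists2 i, (1 <= i <= k)%N & phi (arr_sub w (delta R k i)) <> 0.
  apply: contrapT => nex; apply: ne; rewrite /GTe big_nat big1 // => i ik.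
  rewrite /GTe1 asboolT // [phi _](_ : _ = 0) ?mulr0 //; apply: contrapT => h.
  by apply: nex; exists i.
have [t tL ht] := hb _ phii; have [s hs] := height_nat Sw.
exists s => //; have := @height_add (arr_sub w (delta R k i)) k i ik ltac:(lia).
by rewrite arr_subK hs ht => /esym h; move: tL; rewrite (natr_pred (erefl t%:R) h).
Qed.

(* Raising operators lower the height, so they bring any nonzero vector to a nonzero
   singular one. *)
Lemma GTe_reach_top (K : (arr R -> C) -> Prop) :
  (forall c phi, K phi -> K (fun w => c * phi w)) ->
  (forall k phi, (1 <= k <= n)%N -> K phi -> K (GTe k phi)) ->
  forall L phi, supported phi -> height_bounded L phi -> (exists v, phi v <> 0) ->
  K phi -> K (GTbasis top_arr).
Proof.
move=> KZ Ke; elim=> [|L IHL] phi sphi hb [v phiv] Kphi; first by have [] := hb v phiv.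
have [sing|] := pselect (forall k w, (1 <= k <= n)%N -> GTe k phi w = 0); last first.
  move=> nsing; have [k [w [kn ne]]] : exists k w, (1 <= k <= n)%N /\ GTe k phi w <> 0.
    apply: contrapT => h; apply: nsing => k w kn; apply: contrapT => ne; apply: h.
    by exists k, w.
  apply: (IHL (GTe k phi)); [exact: GTe_supported|exact: GTe_height| |exact: Ke].
  by exists w.
have top := GTe_singular sphi sing.
suff -> : GTbasis top_arr = (fun w => (phi top_arr)^-1 * phi w) by apply: KZ.
apply: funext => w.
have [->|ne] := pselect (w = top_arr).
  by rewrite (GTbasisE top_GTset) mulVf // -(top v phiv); apply/eqP.
rewrite [phi w](_ : _ = 0) ?mulr0; last by apply: contrapT => /top.
by rewrite /GTbasis asboolF // => -[].
Qed.

(** Double induction, on the height and then on the first row where alignment fails. If u_{m,i}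
    differs from u_{m+1,i}, raise it to get [v] of smaller height; f_m T(v) is a nonzero multiple of
    T(u) plus terms of the same height that are already misaligned before row m + 1. *)
Lemma GTf_generate (G : (arr R -> C) -> Prop) :
  G (GTbasis top_arr) ->
  (forall phi psi, G phi -> G psi -> G (fun w => phi w + psi w)) ->
  (forall c phi, G phi -> G (fun w => c * phi w)) ->
  (forall k phi, (1 <= k <= n)%N -> G phi -> G (GTf k phi)) ->
  forall u, G (GTbasis u).
Proof.
move=> Gtop GD GZ Gf.
have G0 : G (fun=> 0).
  have -> : (fun=> 0) = (fun w => 0 * GTbasis top_arr w) by apply: funext => w; rewrite mul0r.
  exact: GZ.
have Gout u : ~ GTset u -> G (GTbasis u).
  move=> nS; suff -> : GTbasis u = (fun=> 0) by [].
  by apply: funext => w; rewrite GTbasis_out.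
have Gsum (F : nat -> arr R -> C) (r : seq nat) (P : pred nat) :
    (forall j, j \in r -> P j -> G (F j)) -> G (fun w => \sum_(j <- r | P j) F j w).
  elim: r => [|j r IHr] GF.
    by under eq_fun do rewrite big_nil.
  under eq_fun do rewrite big_cons.
  have Gr : G (fun w => \sum_(j <- r | P j) F j w).
    by apply: IHr => m mr; apply: GF; rewrite inE mr orbT.
  have [Pj|//] := boolP (P j).
  by apply: GD => //; apply: GF; rewrite ?mem_head.
suff GS t : forall u, GTset u -> height u = t%:R -> G (GTbasis u).
  move=> u; have [Su|/Gout //] := pselect (GTset u).
  by have [t ht] := height_nat Su; apply: (GS t).
elim/ltn_ind: t => t IHt u Su hu.
suff nal m : (m <= n.+1)%N -> forall u, GTset u -> height u = t%:R -> ~ aligned m u ->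
    G (GTbasis u).
  by have [/(aligned_top Su) ->//|] := pselect (aligned n.+1 u); apply: (nal n.+1).
elim: m {u Su hu} => [|m IHm] mn u Su hu nal; first by case: nal.
have [al|] := pselect (aligned m u); last exact: IHm (ltnW mn) _ Su hu.
have [i im ne] : exists2 i, (1 <= i <= m)%N & u m i <> u m.+1 i.
  apply: contrapT => nex; apply: nal => k i ik; rewrite ltnS leq_eqVlt => /predU1P[km|].
    by apply: contrapT => ne; apply: nex; exists i; rewrite -km.
  exact: al.
set v := arr_add u (delta R m i).
have Sv : GTset v by apply: aligned_raise.
have uE : u = arr_sub v (delta R m i) by rewrite arr_addK.
have Gv : G (GTbasis v).
  have [s hs] := height_nat Sv.
  by apply: (IHt s) => //; move: hs; rewrite height_add // => /(natr_pred hu) ->.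
have c0 : coef_f v m i != 0 by apply: coef_f_neq0; rewrite -?uE.
pose rest w := \sum_(j <- index_iota 1 m.+1 | j != i)
  coef_f v m j * GTbasis (arr_sub v (delta R m j)) w.
have Grest : G rest.
  apply: Gsum => j; rewrite mem_index_iota => jm /eqP ji; apply: GZ.
  have [Sj|/Gout //] := pselect (GTset (arr_sub v (delta R m j))).
  apply: (IHm (ltnW mn)) => //; last by apply: aligned_swap.
  have := @height_add (arr_sub v (delta R m j)) m j jm mn.
  by rewrite arr_subK height_add // hu => /addIr.
(* Solve f_m T(v) for T(u); the terms in [rest] are covered by the inner induction through
   [aligned_swap]. *)
have -> : GTbasis u =
    (fun w => (coef_f v m i)^-1 * (GTf m (GTbasis v) w + (-1) * rest w)).
  apply: funext => w; rewrite /GTf (bigD1_seq i) /= ?mem_index_iota ?iota_uniq //.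
  rewrite GTf1_basis // -uE (eq_bigr _ (fun j _ => GTf1_basis m j w Sv)).
  by rewrite -/(rest w) mulN1r addrK mulKf.
by apply: (GZ); apply: GD; [apply: Gf => //; lia|apply: GZ].
Qed.

End GTSet.

(** * Matrix units and Chevalley generators *)

Section Matrices.
Variable R : realType.
Local Notation C := R[i].
Variable n : nat.
Local Notation M := 'M[C]_(n.+1).
Local Notation Eu := (Eu R n).
Local Notation gt_e := (gt_e R n).
Local Notation gt_f := (gt_f R n).
Local Notation gt_h := (gt_h R n).

Lemma EuM a b c d : (1 <= b <= n.+1)%N ->
  Eu a b *m Eu c d = (b.-1 == c.-1)%:R *: Eu a d.
Proof.
move=> bn; have bn' : (b.-1 < n.+1)%N by lia.
apply/matrixP => i j; rewrite !mxE (bigD1 (Ordinal bn')) //= big1 ?addr0.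
  rewrite !mxE /= eqxx andbT.
  by case: (_ == a.-1); case: (_ == c.-1); case: (_ == d.-1); rewrite /=; ring.
by move=> l lb; rewrite !mxE (negbTE (_ : (l : nat) != b.-1)) // andbF mul0r.
Qed.

Lemma Eu_delta (i j : 'I_n.+1) : Eu i.+1 j.+1 = delta_mx i j.
Proof. by apply/matrixP => i' j'; rewrite !mxE. Qed.

Lemma sl_Eu a b : (1 <= a)%N -> (1 <= b)%N -> a != b -> sl (Eu a b).
Proof.
move=> a1 b1 ab; rewrite /sl /mxtrace big1 // => i _; rewrite mxE.
by case: eqP => //= ->; rewrite (_ : (a.-1 == b.-1) = false) //; lia.
Qed.

Lemma sl_lie (x y : M) : sl (lie x y).
Proof. by rewrite /sl /lie mxtraceD raddfN /= mxtrace_mulC subrr. Qed.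

Lemma sl_lin (c : C) (x y : M) : sl x -> sl y -> sl (c *: x + y).
Proof. by rewrite /sl => x0 y0; rewrite mxtraceD mxtraceZ x0 y0 mulr0 addr0. Qed.

Lemma sl0 : sl (0 : M). Proof. exact: mxtrace0. Qed.

Lemma sl_gt_e k : (1 <= k <= n)%N -> sl (gt_e k).
Proof. by move=> kn; apply: sl_Eu; lia. Qed.

Lemma sl_gt_f k : (1 <= k <= n)%N -> sl (gt_f k).
Proof. by move=> kn; apply: sl_Eu; lia. Qed.

Lemma lie_gt_ef k l : (1 <= k <= n)%N -> (1 <= l <= n)%N ->
  lie (gt_e k) (gt_f l) = if k == l then gt_h k else 0.
Proof.
move=> kn ln; rewrite /lie !EuM; [|lia|lia].
rewrite !succnK (_ : (l.-1 == k.-1) = (k == l)); last by lia.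
by case: eqP => [->|_]; rewrite ?scale1r ?scale0r ?subrr.
Qed.

Lemma sl_gt_h k : (1 <= k <= n)%N -> sl (gt_h k).
Proof. by move=> kn; have := sl_lie (gt_e k) (gt_f k); rewrite lie_gt_ef ?eqxx. Qed.

Lemma lie_gt_hf k l : (1 <= k <= n)%N -> (1 <= l <= n)%N ->
  lie (gt_h k) (gt_f l) = - cartan_entry R k l *: gt_f l.
Proof.
move=> kn ln; rewrite /lie /gt_h mulmxBl mulmxBr !EuM; [|lia|lia|lia|lia].
rewrite /= /cartan_entry.
rewrite (_ : (k.-1 == l) = (k == l.+1)); last by lia.
rewrite (_ : (l.-1 == k.-1) = (k == l)); last by lia.
rewrite (_ : (l.-1 == k) = (k.+1 == l)); last by lia.
have h1 : (k == l.+1)%:R *: Eu k l = (k == l.+1)%:R *: gt_f l.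
  by case: eqP => [->|_] //; rewrite !scale0r.
have h2 : (k == l)%:R *: Eu k.+1 l = (k == l)%:R *: gt_f l.
  by case: eqP => [->|_] //; rewrite !scale0r.
have h3 : (k == l)%:R *: Eu l.+1 k = (k == l)%:R *: gt_f l.
  by case: eqP => [->|_] //; rewrite !scale0r.
have h4 : (k.+1 == l)%:R *: Eu l.+1 k.+1 = (k.+1 == l)%:R *: gt_f l.
  by case: eqP => [->|_] //; rewrite !scale0r.
by rewrite h1 h2 h3 h4 -!scalerBl; congr (_ *: _); ring.
Qed.

(* Up to a scalar matrix this is diag(0, -1, ..., -n); it grades f-monomials by length. *)
Definition grading_mx : M :=
  let d := diag_mx (\row_i - (i : nat)%:R) in d - ((\tr d) / n.+1%:R)%:M.

Lemma cartan_grading : cartan grading_mx.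
Proof.
split; last first.
  rewrite /grading_mx mxtraceD raddfN /= mxtrace_scalar -[X in _ - X]mulr_natr divfK ?subrr //.
  by rewrite pnatr_eq0.
apply/is_diag_mxP => i j ij; rewrite !mxE.
by rewrite (negbTE (_ : i != j)) ?mulr0n ?subrr //; apply: contraNneq ij => ->.
Qed.

Lemma lie_grading_f l : (1 <= l <= n)%N -> lie grading_mx (gt_f l) = - gt_f l.
Proof.
move=> ln; rewrite /lie /grading_mx mulmxBl mulmxBr scalar_mxC opprB addrA subrK.
apply/matrixP => i j; rewrite mul_diag_mx mul_mx_diag !mxE.
have [/andP[/eqP -> /eqP ->]|_] := boolP (_ && _); last by rewrite mulr0 mul0r subrr oppr0.
by rewrite succnK -[in LHS](prednK (_ : (0 < l)%N)) ?succnK -?natr1; [ring|lia].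
Qed.

End Matrices.

(** * Consequences of the module axioms *)

Section Module.
Variable R : realType.
Local Notation C := R[i].
Variable n : nat.
Local Notation M := 'M[C]_(n.+1).
Local Notation Eu := (Eu R n).
Local Notation gt_e := (gt_e R n).
Local Notation gt_f := (gt_f R n).
Local Notation gt_h := (gt_h R n).
Variables (V : lmodType C) (rho : M -> V -> V).
Hypothesis gm : is_gmod rho.

Lemma gmodD x v w : rho x (v + w) = rho x v + rho x w.
Proof. by case: gm => lin _ _; rewrite -[v in LHS]scale1r lin scale1r. Qed.

Lemma gmod0 x : rho x 0 = 0.
Proof. by apply: (addrI (rho x 0)); rewrite -gmodD !addr0. Qed.

Lemma gmodZ x c v : rho x (c *: v) = c *: rho x v.
Proof. by case: gm => lin _ _; rewrite -[c *: v]addr0 lin gmod0 addr0. Qed.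

Lemma gmodB x v w : rho x (v - w) = rho x v - rho x w.
Proof. by rewrite gmodD -scaleN1r gmodZ scaleN1r. Qed.

Lemma gmod_lin x y c v : sl x -> sl y -> rho (c *: x + y) v = c *: rho x v + rho y v.
Proof. by case: gm => _ lin _; apply: lin. Qed.

Lemma gmod_lie x y v : sl x -> sl y ->
  rho (lie x y) v = rho x (rho y v) - rho y (rho x v).
Proof. by case: gm => _ _ br; apply: br. Qed.

Lemma gmod_0 v : rho 0 v = 0.
Proof.
have := @gmod_lin 0 0 1 v (sl0 R n) (sl0 R n); rewrite scale1r addr0 scale1r => e.
by apply: (addrI (rho 0 v)); rewrite -e addr0.
Qed.

Lemma gmod_scale x c v : sl x -> rho (c *: x) v = c *: rho x v.
Proof. by move=> sx; rewrite -[c *: x]addr0 gmod_lin ?gmod_0 ?addr0 //; apply: sl0. Qed.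

Lemma gmod_ef k l x : (1 <= k <= n)%N -> (1 <= l <= n)%N ->
  rho (gt_e k) (rho (gt_f l) x) =
  rho (gt_f l) (rho (gt_e k) x) + (if k == l then rho (gt_h k) x else 0).
Proof.
move=> kn ln; have := gmod_lie x (sl_gt_e R kn) (sl_gt_f R ln); rewrite lie_gt_ef //.
by case: ifP => _; rewrite ?gmod_0 => ->; rewrite addrC subrK.
Qed.

Lemma gmod_hf k l x : (1 <= k <= n)%N -> (1 <= l <= n)%N ->
  rho (gt_h k) (rho (gt_f l) x) =
  rho (gt_f l) (rho (gt_h k) x) - cartan_entry R k l *: rho (gt_f l) x.
Proof.
move=> kn ln; have := gmod_lie x (sl_gt_h R kn) (sl_gt_f R ln); rewrite lie_gt_hf //.
by rewrite gmod_scale ?scaleNr; [move=> ->; rewrite addrC subrK|apply: sl_gt_f].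
Qed.

Lemma gmod_gradf l x : (1 <= l <= n)%N ->
  rho (grading_mx R n) (rho (gt_f l) x) =
  rho (gt_f l) (rho (grading_mx R n) x) - rho (gt_f l) x.
Proof.
move=> ln; have [_ sg] := cartan_grading R n.
have := gmod_lie x sg (sl_gt_f R ln); rewrite lie_grading_f // -(scaleN1r (gt_f l)).
by rewrite gmod_scale ?scaleN1r; [move=> ->; rewrite addrC subrK|apply: sl_gt_f].
Qed.

(** The elements of g preserving [U] form a Lie subalgebra; it contains the e_k and f_k, hence by
    iterated brackets all off-diagonal matrix units and their brackets. *)
Lemma submodule_gen (U : V -> Prop) : U 0 ->
  (forall v w, U v -> U w -> U (v + w)) -> (forall c v, U v -> U (c *: v)) ->
  (forall k v, (1 <= k <= n)%N -> U v -> U (rho (gt_e k) v)) ->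
  (forall k v, (1 <= k <= n)%N -> U v -> U (rho (gt_f k) v)) ->
  submodule rho U.
Proof.
move=> U0 UD UZ Ue Uf; split=> // x v sx.
pose A (y : M) := sl y /\ forall v, U v -> U (rho y v).
have A0 : A 0 by split; [exact: sl0|move=> w _; rewrite gmod_0].
have Alin c y z : A y -> A z -> A (c *: y + z).
  move=> [sy Ay] [sz Az]; split; first exact: sl_lin.
  by move=> w Uw; rewrite gmod_lin //; apply: UD; [apply/UZ/Ay|apply: Az].
have Alie y z : A y -> A z -> A (lie y z).
  move=> [sy Ay] [sz Az]; split; first exact: sl_lie.
  move=> w Uw; rewrite gmod_lie // -scaleN1r; apply: UD; first exact/Ay/Az.
  exact/UZ/Az/Ay.
have Ae k : (1 <= k <= n)%N -> A (gt_e k).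
  by move=> kn; split; [apply: sl_gt_e|move=> w; apply: Ue].
have Af k : (1 <= k <= n)%N -> A (gt_f k).
  by move=> kn; split; [apply: sl_gt_f|move=> w; apply: Uf].
have Aup i d : (1 <= i)%N -> (i + d.+1 <= n.+1)%N -> A (Eu i (i + d.+1)).
  move=> i1; elim: d => [|d IHd] idn; first by rewrite addn1; apply: Ae; lia.
  suff -> : Eu i (i + d.+2) = lie (Eu i (i + d.+1)) (gt_e (i + d.+1)).
    by apply: Alie; [apply: IHd|apply: Ae]; lia.
  rewrite /lie !EuM; [|lia|lia]; rewrite eqxx (_ : (_ == i.-1) = false); last by lia.
  by rewrite scale1r scale0r subr0 addnS.
have Alow i d : (1 <= i)%N -> (i + d.+1 <= n.+1)%N -> A (Eu (i + d.+1) i).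
  move=> i1; elim: d => [|d IHd] idn; first by rewrite addn1; apply: Af; lia.
  suff -> : Eu (i + d.+2) i = lie (gt_f (i + d.+1)) (Eu (i + d.+1) i).
    by apply: Alie; [apply: Af|apply: IHd]; lia.
  rewrite /lie !EuM; [|lia|lia]; rewrite eqxx (_ : (i.-1 == _) = false); last by lia.
  by rewrite scale1r scale0r subr0 addnS.
have Adelta (i j : 'I_n.+1) : i != j -> A (delta_mx i j).
  move=> ij; rewrite -Eu_delta; have := ltn_ord i; have := ltn_ord j => jn iN.
  case: (ltngtP i j) => [lt|gt|/ord_inj e].
  - rewrite (_ : j.+1 = (i.+1 + (j - i.+1).+1)%N); last by lia.
    by apply: Aup; lia.
  - rewrite (_ : i.+1 = (j.+1 + (i - j.+1).+1)%N); last by lia.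
    by apply: Alow; lia.
  - by rewrite e eqxx in ij.
(* A traceless matrix has the same coefficients in this family as in the matrix units: the
   corrections at the last diagonal entry add up to the trace. *)
pose B (i j : 'I_n.+1) : M :=
  if i == j then delta_mx i i - delta_mx ord_max ord_max else delta_mx i j.
have AB i j : A (B i j).
  rewrite /B; case: eqVneq => [_|ij]; last exact: Adelta.
  have [->|im] := eqVneq i ord_max; first by rewrite subrr.
  suff -> : delta_mx i i - delta_mx ord_max ord_max =
      lie (delta_mx i ord_max) (delta_mx ord_max i) :> M.
    by apply: Alie; apply: Adelta; rewrite // eq_sym.
  by rewrite /lie !mul_delta_mx.
suff xE : x = \sum_i \sum_j x i j *: B i j.
  suff [_] : A x by apply.
  rewrite xE; apply: (big_ind A) => // [y z Ay Az|i _].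
    by rewrite -[y]scale1r; apply: Alin.
  apply: (big_ind A) => // [y z Ay Az|j _]; first by rewrite -[y]scale1r; apply: Alin.
  by rewrite -[_ *: _]addr0; apply: Alin.
have -> : \sum_i \sum_j x i j *: B i j =
    \sum_i (\sum_j x i j *: delta_mx i j - x i i *: delta_mx ord_max ord_max).
  apply: eq_bigr => i _; rewrite (bigD1 i) //= [in RHS](bigD1 i) //= addrAC.
  rewrite -scalerBr {1}/B eqxx; congr (_ + _); apply: eq_bigr => j ji.
  by rewrite /B eq_sym (negbTE ji).
by rewrite sumrB -matrix_sum_delta -scaler_suml -/(\tr x) sx scale0r subr0.
Qed.

End Module.

(** * Linearity and finitely supported coordinate functions *)

Section Operators.
Variables (R : realType) (n : nat) (a : nat -> R[i]).
Local Notation C := R[i].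
Implicit Types (phi psi : arr R -> C) (k : nat) (c : C).

Lemma GTe_add k phi psi w :
  GTe n a k (fun u => phi u + psi u) w = GTe n a k phi w + GTe n a k psi w.
Proof.
rewrite /GTe -big_split; apply: eq_bigr => i _ /=; rewrite /GTe1.
by case: ifP => _; rewrite ?mulrDr ?addr0.
Qed.

Lemma GTf_add k phi psi w :
  GTf n a k (fun u => phi u + psi u) w = GTf n a k phi w + GTf n a k psi w.
Proof.
rewrite /GTf -big_split; apply: eq_bigr => i _ /=; rewrite /GTf1.
by case: ifP => _; rewrite ?mulrDr ?addr0.
Qed.

Lemma GTe_scale k c phi w : GTe n a k (fun u => c * phi u) w = c * GTe n a k phi w.
Proof.
rewrite /GTe mulr_sumr; apply: eq_bigr => i _ /=; rewrite /GTe1.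
by case: ifP => _; rewrite ?mulr0 // mulrCA.
Qed.

Lemma GTf_scale k c phi w : GTf n a k (fun u => c * phi u) w = c * GTf n a k phi w.
Proof.
rewrite /GTf mulr_sumr; apply: eq_bigr => i _ /=; rewrite /GTf1.
by case: ifP => _; rewrite ?mulr0 // mulrCA.
Qed.

Definition basis_sum (s : seq (C * arr R)) w : C := \sum_(p <- s) p.1 * GTbasis n a p.2 w.
(** Finite support makes these functions coordinates of actual vectors and bounds their height.
    Arrays outside the set may occur in the list, where they contribute 0. *)
Definition fin_supported phi := exists s, phi = basis_sum s.

Lemma fin_supportedD phi psi : fin_supported phi -> fin_supported psi ->
  fin_supported (fun w => phi w + psi w).
Proof.
move=> [s ->] [t ->]; exists (s ++ t); apply: funext => w.
by rewrite /basis_sum big_cat.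
Qed.

Lemma fin_supportedZ c phi : fin_supported phi -> fin_supported (fun w => c * phi w).
Proof.
move=> [s ->]; exists [seq (c * p.1, p.2) | p <- s]; apply: funext => w.
by rewrite /basis_sum big_map mulr_sumr; apply: eq_bigr => p _; rewrite mulrA.
Qed.

Lemma fin_supported_basis u : fin_supported (GTbasis n a u).
Proof. by exists [:: (1, u)]; apply: funext => w; rewrite /basis_sum big_seq1 mul1r. Qed.

Lemma GTe_basis k v : GTset n a v -> GTe n a k (GTbasis n a v) =
  (fun w => - \sum_(1 <= i < k.+1) coef_e v k i * GTbasis n a (arr_add v (delta R k i)) w).
Proof.
move=> Sv; apply: funext => w; rewrite /GTe -sumrN.
by apply: eq_bigr => i _; rewrite GTe1_basis // mulNr.
Qed.

Lemma GTf_basis k v : GTset n a v -> GTf n a k (GTbasis n a v) =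
  (fun w => \sum_(1 <= i < k.+1) coef_f v k i * GTbasis n a (arr_sub v (delta R k i)) w).
Proof.
by move=> Sv; apply: funext => w; rewrite /GTf; apply: eq_bigr => i _; rewrite GTf1_basis.
Qed.

Lemma fin_supported_GTf k phi : fin_supported phi -> fin_supported (GTf n a k phi).
Proof.
move=> [s ->]; elim: s => [|p s IHs].
  exists [::]; apply: funext => w; rewrite /GTf big1 ?/basis_sum ?big_nil // => i _.
  by rewrite /GTf1 /basis_sum big_nil mulr0 if_same.
have -> : basis_sum (p :: s) = (fun w => p.1 * GTbasis n a p.2 w + basis_sum s w).
  by apply: funext => w; rewrite /basis_sum big_cons.
have -> : GTf n a k (fun w => p.1 * GTbasis n a p.2 w + basis_sum s w) =
    (fun w => p.1 * GTf n a k (GTbasis n a p.2) w + GTf n a k (basis_sum s) w).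
  by apply: funext => w; rewrite GTf_add GTf_scale.
apply: fin_supportedD => //; apply: fin_supportedZ.
have [Sp|nSp] := pselect (GTset n a p.2).
  rewrite GTf_basis //.
  exists [seq (coef_f p.2 k i, arr_sub p.2 (delta R k i)) | i <- index_iota 1 k.+1].
  by apply: funext => w; rewrite /basis_sum big_map.
exists [::]; apply: funext => w; rewrite /basis_sum big_nil /GTf big1 // => i _.
by rewrite /GTf1 GTbasis_out // mulr0 if_same.
Qed.

Lemma fin_supported_height phi : fin_supported phi -> exists L, height_bounded n a L phi.
Proof.
move=> [s ->]; elim: s => [|p s [L IHs]].
  by exists 0%N => v; rewrite /basis_sum big_nil.
have [Sp|nSp] := pselect (GTset n a p.2); last first.
  exists L => v; rewrite /basis_sum big_cons GTbasis_out // mulr0 add0r; exact: IHs.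
have [t ht] := height_nat Sp; exists (maxn t.+1 L) => v.
rewrite /basis_sum big_cons => ne.
have [bs|bs] := pselect (basis_sum s v = 0).
  have [|_ ->] := @GTbasis_neq0 _ n a p.2 v; last by exists t; rewrite // leq_max leqnn.
  by move=> b0; apply: ne; rewrite b0 mulr0 add0r.
by have [t' tL ht'] := IHs v bs; exists t'; rewrite // leq_max tL orbT.
Qed.

End Operators.

(** * The isomorphism with the simple highest weight module *)

Section HighestWeight.
Variable R : realType.
Local Notation C := R[i].
Variable n : nat.
Local Notation M := 'M[C]_(n.+1).
Local Notation gt_e := (gt_e R n).
Local Notation gt_f := (gt_f R n).
Local Notation gt_h := (gt_h R n).
Variables (V : lmodType C) (rho : M -> V -> V).
Hypotheses (gm : is_gmod rho) (simple : simple_gmod rho).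
Variables (lam : M -> C) (v0 : V).
Hypothesis hw : hw_vector rho id lam v0.
Variable a : nat -> C.
Hypothesis a_regular :
  forall i j, (1 <= i < j)%N -> (j <= n.+1)%N -> ~ natle (a i) (a j).
(** So [a] gives the coordinates of lambda + rho up to a common summand; the 1 is the value of rho
    on the coroot h_k. *)
Hypothesis lam_h : forall k, (1 <= k <= n)%N -> lam (gt_h k) = a k - a k.+1 - 1.

Local Notation S := (GTset n a).
Local Notation top := (top_arr n a).
Local Notation bas := (GTbasis n a).
Local Notation tame_e := (GTe n a).
Local Notation tame_f := (GTf n a).

(* The submodule generated by (v0, T(top)) in the product of V with the module of
   Gelfand-Tsetlin coordinate functions; it turns out to be the graph of an isomorphism. *)
Inductive graph : V -> (arr R -> C) -> Prop :=
| graph_top : graph v0 (bas top)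
| graphD : forall x phi y psi, graph x phi -> graph y psi ->
    graph (x + y) (fun w => phi w + psi w)
| graphZ : forall c x phi, graph x phi -> graph (c *: x) (fun w => c * phi w)
| graph_f : forall k x phi, (1 <= k <= n)%N -> graph x phi ->
    graph (rho (gt_f k) x) (tame_f k phi).

Lemma graph_supported x phi : graph x phi -> supported n a phi.
Proof.
elim=> [|{}x {}phi y psi _ IH1 _ IH2|c {}x {}phi _ IH|k {}x {}phi _ _ _] v nS.
- exact: GTbasis_supported.
- by rewrite IH1 ?IH2 ?addr0.
- by rewrite IH ?mulr0.
- exact: GTf_supported.
Qed.

Lemma graph_fin x phi : graph x phi -> fin_supported n a phi.
Proof.
elim=> [|{}x {}phi y psi _ IH1 _ IH2|c {}x {}phi _ IH|k {}x {}phi _ _ IH].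
- exact: fin_supported_basis.
- exact: fin_supportedD.
- exact: fin_supportedZ.
- exact: fin_supported_GTf.
Qed.

Lemma graph_eq x phi y psi : x = y -> (forall w, phi w = psi w) ->
  graph x phi -> graph y psi.
Proof. by move=> -> /funext ->. Qed.

Lemma graphB x phi y psi : graph x phi -> graph y psi ->
  graph (x - y) (fun w => phi w - psi w).
Proof.
move=> g1 g2; apply: graph_eq (graphD g1 (graphZ (-1) g2)); first by rewrite scaleN1r.
by move=> w; rewrite mulN1r.
Qed.

Lemma graph0 : graph 0 (fun=> 0).
Proof.
by apply: graph_eq (graphZ 0 graph_top); [rewrite scale0r|move=> w; rewrite mul0r].
Qed.

Lemma graph_sum (F : nat -> V) (G : nat -> arr R -> C) (r : seq nat) :
  (forall i, graph (F i) (G i)) ->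
  graph (\sum_(i <- r) F i) (fun w => \sum_(i <- r) G i w).
Proof.
move=> FG; elim: r => [|i r IHr].
  by apply: graph_eq graph0; [rewrite big_nil|move=> w; rewrite big_nil].
by apply: graph_eq (graphD (FG i) IHr); [rewrite big_cons|move=> w; rewrite big_cons].
Qed.

Lemma coef_h_top k : (1 <= k <= n)%N -> coef_h top k = lam (gt_h k).
Proof.
move=> kn; rewrite lam_h // /coef_h.
have tops m : (m <= n.+1)%N -> \sum_(1 <= i < m.+1) top m i = \sum_(1 <= i < m.+1) a i.
  move=> mn; rewrite !big_nat; apply: eq_bigr => i im.
  by rewrite /top_arr /in_triangle (_ : [&& _, _ & _] = true) //; lia.
have := tops k.-1; rewrite prednK ?tops; [|lia..].
move=> ->; last by lia.
rewrite [X in 2 * X]big_nat_recr /=; last by lia.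
rewrite [\sum_(1 <= i < k.+2) _]big_nat_recr /=; last by lia.
rewrite [\sum_(1 <= i < k.+1) _]big_nat_recr /=; last by lia.
by ring.
Qed.

Lemma cartan_gt_h k : (1 <= k <= n)%N -> cartan (gt_h k).
Proof.
move=> kn; split; last exact: sl_gt_h.
apply/is_diag_mxP => i j ij; rewrite !mxE.
have h m : ((i : nat) == m) && ((j : nat) == m) = false.
  by apply/negP => /andP[/eqP e1 /eqP e2]; rewrite e1 e2 eqxx in ij.
by rewrite !h subrr.
Qed.

Lemma graph_h k x phi : (1 <= k <= n)%N -> graph x phi ->
  graph (rho (gt_h k) x) (fun w => coef_h w k * phi w).
Proof.
move=> kn; elim=> [|{}x {}phi y psi _ IH1 _ IH2|c {}x {}phi _ IH|l {}x {}phi ln g IH].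
- have [_ hwl _] := hw; apply: graph_eq (graphZ (coef_h top k) graph_top).
    by rewrite (hwl _ (cartan_gt_h kn)) coef_h_top.
  move=> w; rewrite /GTbasis; case: asboolP => [[_ ->] //|_]; by rewrite !mulr0.
- by apply: graph_eq (graphD IH1 IH2); [rewrite gmodD|move=> w; rewrite mulrDr].
- by apply: graph_eq (graphZ c IH); [rewrite gmodZ|move=> w; rewrite mulrCA].
- apply: graph_eq (graphB (graph_f ln IH) (graphZ (cartan_entry R k l) (graph_f ln g))).
    by rewrite gmod_hf.
  by move=> w; rewrite GTf_weight //; lia.
Qed.

(** The constructors provide lowering operators only. Moving e_k to the right past each f_l obeys
    the same commutation relation in both components, and both highest weight vectors are killed by
    e_k. *)
Lemma graph_e k x phi : (1 <= k <= n)%N -> graph x phi ->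
  graph (rho (gt_e k) x) (tame_e k phi).
Proof.
move=> kn; elim=> [|{}x {}phi y psi _ IH1 _ IH2|c {}x {}phi _ IH|l {}x {}phi ln g IH].
- have [_ _ hwn] := hw; apply: graph_eq graph0.
    rewrite hwn // => i j ji; rewrite mxE; case: eqP => //= ik; case: eqP => //= jk.
    by lia.
  move=> w; rewrite GTe_basis; last exact: top_GTset.
  rewrite big_nat big1 ?oppr0 // => i ik.
  by rewrite GTbasis_out ?mulr0 //; apply: top_raise_out; lia.
- by apply: graph_eq (graphD IH1 IH2); [rewrite gmodD|move=> w; rewrite GTe_add].
- by apply: graph_eq (graphZ c IH); [rewrite gmodZ|move=> w; rewrite GTe_scale].
- have comm w := GTe_GTf w (graph_supported g) kn ln.
  rewrite gmod_ef //; have gf := graph_f ln IH.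
  case: eqVneq comm => _ comm.
    apply: graph_eq (graphD gf (graph_h kn g)); rewrite //.
    by move=> w; rewrite -comm addrC subrK.
  by apply: graph_eq gf; [rewrite addr0|move=> w; rewrite -[LHS]addr0 -(comm w) addrC subrK].
Qed.

(* sum of the eigenspaces of [grading_mx] for the eigenvalues lam - 1, ..., lam - L *)
Fixpoint lower_sum (L : nat) (x : V) : Prop :=
  if L is L'.+1 then
    exists y z, [/\ x = y + z, lower_sum L' y
      & rho (grading_mx R n) z = (lam (grading_mx R n) - L%:R) *: z]
  else x = 0.

Lemma lower_sum0 L : lower_sum L 0.
Proof.
by elim: L => //= L IHL; exists 0, 0; split; rewrite ?addr0 ?gmod0 ?scaler0.
Qed.

Lemma lower_sumD L x y : lower_sum L x -> lower_sum L y -> lower_sum L (x + y).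
Proof.
elim: L x y => [|L IHL] x y /= => [-> ->|[x1 [x2 [-> h1 e1]]] [y1 [y2 [-> h2 e2]]]].
  by rewrite addr0.
exists (x1 + y1), (x2 + y2); split; first by rewrite addrACA.
  exact: IHL.
by rewrite gmodD // e1 e2 scalerDr.
Qed.

Lemma lower_sumZ L c x : lower_sum L x -> lower_sum L (c *: x).
Proof.
elim: L x => [|L IHL] x /= => [->|[x1 [x2 [-> h1 e1]]]]; first by rewrite scaler0.
exists (c *: x1), (c *: x2); split; [by rewrite scalerDr|exact: IHL|].
by rewrite gmodZ // e1 !scalerA mulrC.
Qed.

Lemma lower_sum_leq L L' x : (L <= L')%N -> lower_sum L x -> lower_sum L' x.
Proof.
move=> /subnK <-; elim: (_ - _)%N => //= d IHd /IHd h.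
by exists x, 0; split; rewrite ?addr0 // gmod0 // scaler0.
Qed.

Lemma lower_sum_f L k x : (1 <= k <= n)%N -> lower_sum L x ->
  lower_sum L.+1 (rho (gt_f k) x).
Proof.
move=> kn; elim: L x => [|L IHL] x; first by move=> ->; rewrite gmod0 //; apply: lower_sum0.
move=> [y [z [-> h e]]]; exists (rho (gt_f k) y), (rho (gt_f k) z).
split; [by rewrite gmodD|exact: IHL|].
by rewrite gmod_gradf // e gmodZ // -[X in _ - X]scale1r -scalerBl -[L.+2%:R]natr1 opprD addrA.
Qed.

Lemma lower_sum_grade L x : lower_sum L x -> lower_sum L (rho (grading_mx R n) x).
Proof.
elim: L x => [|L IHL] x /= => [->|[y [z [-> h e]]]]; first by rewrite gmod0.
exists (rho (grading_mx R n) y), (rho (grading_mx R n) z).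
by split; [rewrite gmodD|exact: IHL|rewrite e gmodZ // e].
Qed.

(** Eigenvalues are distinct: with d = lam(D) for the grading element D, applying D - (d - m) kills
    the last component and multiplies [x] by m, which is nonzero, so [x] lies in a shorter sum. *)
Lemma lower_sum_eigen L x : rho (grading_mx R n) x = lam (grading_mx R n) *: x ->
  lower_sum L x -> x = 0.
Proof.
move=> ex; elim: L => //= L IHL [y [z [xE h e]]]; apply: IHL.
set d := lam _ in ex e; set m : C := L.+1%:R in e.
have m0 : m != 0 by rewrite pnatr_eq0.
have Dy : rho (grading_mx R n) y = m *: x + (d - m) *: y.
  have yE : y = x - z by rewrite xE addrK.
  have zE : z = x - y by rewrite xE addrAC subrr add0r.
  rewrite {1}yE gmodB // ex e zE scalerBr opprB addrA addrAC; congr (_ + _).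
  by rewrite -scalerBl; congr (_ *: _); ring.
have -> : x = m^-1 *: (rho (grading_mx R n) y + (m - d) *: y).
  by rewrite Dy -addrA -scalerDl addrA subrK subrr scale0r addr0 scalerA mulVf // scale1r.
apply: lower_sumZ; apply: lower_sumD; first exact: lower_sum_grade.
exact: lower_sumZ.
Qed.

(** The coefficient of [v0] in [x], modulo strictly lower eigenspaces, is the coefficient of T(top)
    in [phi]. Hence neither (v0, 0) nor (0, T(top)) can occur in the graph. *)
Lemma graph_lower x phi : graph x phi -> exists L, lower_sum L (x - phi top *: v0).
Proof.
have Stop := top_GTset a_regular.
elim=> [|{}x {}phi y psi _ [L1 h1] _ [L2 h2]|c {}x {}phi _ [L h]|k {}x {}phi kn g [L h]].
- by exists 0%N; rewrite GTbasisE // scale1r subrr.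
- exists (maxn L1 L2); rewrite scalerDl opprD addrACA; apply: lower_sumD.
    by apply: lower_sum_leq h1; rewrite leq_maxl.
  by apply: lower_sum_leq h2; rewrite leq_maxr.
- by exists L; rewrite -scalerA -scalerBr; apply: lower_sumZ.
- exists L.+1; have -> : tame_f k phi top = 0.
    rewrite /GTf big_nat big1 // => i ik; rewrite /GTf1 (graph_supported g) ?mulr0 ?if_same //.
    by apply: top_raise_out; lia.
  rewrite scale0r subr0 -[x](subrK (phi top *: v0)) gmodD //; apply: lower_sumD.
    exact: lower_sum_f.
  rewrite gmodZ //; apply: lower_sumZ; apply: (@lower_sum_leq 1) => //.
  exists 0, (rho (gt_f k) v0); split; rewrite ?add0r // gmod_gradf //.
  have [_ hwl _] := hw; rewrite (hwl _ (cartan_grading R n)) gmodZ //.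
  by rewrite scalerBl scale1r.
Qed.

Lemma top_not_lower L c : c != 0 -> ~ lower_sum L (c *: v0).
Proof.
move=> c0 h; have [v0N hwl _] := hw; apply: v0N.
apply: (@lower_sum_eigen L); first by rewrite (hwl _ (cartan_grading R n)).
by rewrite -[v0](scalerK c0); apply: lower_sumZ.
Qed.

(** These [x] form a submodule of a simple module; were it everything, it would contain [v0],
    against [graph_lower]. *)
Lemma graph_left0 x : graph x (fun=> 0) -> x = 0.
Proof.
have [_ simp] := simple.
have sub : submodule rho (fun x => graph x (fun=> 0)).
  apply: submodule_gen => //.
  - exact: graph0.
  - by move=> v w gv gw; apply: graph_eq (graphD gv gw) => // u; rewrite addr0.
  - by move=> c v gv; apply: graph_eq (graphZ c gv) => // u; rewrite mulr0.
  - move=> k v kn gv; apply: graph_eq (graph_e kn gv) => // u.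
    by rewrite /GTe big1 // => i _; rewrite /GTe1 mulr0 if_same.
  - move=> k v kn gv; apply: graph_eq (graph_f kn gv) => // u.
    by rewrite /GTf big1 // => i _; rewrite /GTf1 mulr0 if_same.
case: (simp _ sub) => [all0 /all0 //|/(_ v0)/graph_lower[L]].
by rewrite scale0r subr0 -[v0]scale1r => /top_not_lower; rewrite oner_eq0 => /(_ isT).
Qed.

Lemma graph_inj x y phi : graph x phi -> graph y phi -> x = y.
Proof.
move=> gx gy; apply/eqP; rewrite -subr_eq0; apply/eqP/graph_left0.
by apply: graph_eq (graphB gx gy) => // w; rewrite subrr.
Qed.

(** Here simplicity on the Gelfand-Tsetlin side enters: raising operators would turn a nonzero [phi]
    into T(top) while keeping the left component 0. *)
Lemma graph_right0 phi : graph 0 phi -> forall w, phi w = 0.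
Proof.
move=> g w; apply: contrapT => ne.
have [L hL] := fin_supported_height (graph_fin g).
have : graph 0 (bas top).
  apply: (GTe_reach_top a_regular (K := graph 0) _ _ (graph_supported g) hL) => //.
  - by move=> c psi gpsi; apply: graph_eq (graphZ c gpsi) => //; rewrite scaler0.
  - by move=> k psi kn gpsi; apply: graph_eq (graph_e kn gpsi) => //; rewrite gmod0.
  - by exists w.
move=> /graph_lower[L']; rewrite (GTbasisE (top_GTset a_regular)) sub0r -scaleNr.
by apply: top_not_lower; rewrite oppr_eq0 oner_eq0.
Qed.

Lemma graph_basis u : exists x, graph x (bas u).
Proof.
apply: (GTf_generate (G := fun phi => exists x, graph x phi)).
- by exists v0; exact: graph_top.
- by move=> phi psi [x gx] [y gy]; exists (x + y); exact: graphD.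
- by move=> c phi [x gx]; exists (c *: x); exact: graphZ.
- by move=> k phi kn [x gx]; exists (rho (gt_f k) x); exact: graph_f.
Qed.

Lemma graph_total x : exists phi, graph x phi.
Proof.
have [_ simp] := simple; have [v0N _ _] := hw.
have sub : submodule rho (fun x => exists phi, graph x phi).
  apply: submodule_gen => //.
  - by exists (fun=> 0); exact: graph0.
  - by move=> v w [phi gv] [psi gw]; eexists; exact: (graphD gv gw).
  - by move=> c v [phi gv]; eexists; exact: (graphZ c gv).
  - by move=> k v kn [phi gv]; eexists; exact: (graph_e kn gv).
  - by move=> k v kn [phi gv]; eexists; exact: (graph_f kn gv).
case: (simp _ sub) => [all0|/(_ x) //].
by case: v0N; apply: all0; exists (bas top); exact: graph_top.
Qed.

(** T(u) is the vector paired with the coordinate function of [u]. Independence comes from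
    [graph_right0], spanning from totality with finite support, and the formulas from [graph_inj],
    since both sides have the same coordinates. *)
Lemma highest_weight_strongly_tame : strongly_tame_GT rho.
Proof.
pose T u : V := projT1 (cid (graph_basis u)).
have gT u : graph (T u) (bas u) by exact: (projT2 (cid (graph_basis u))).
exists S, T; split.
- by move=> w [out _ _ _] j i; apply: out.
- move=> w nS; apply: graph_left0; apply: graph_eq (gT w) => // u.
  by rewrite GTbasis_out.
- move=> m w c winj Sw sum0 l.
  have g : graph (\sum_(l < m) c l *: T (w l)) (fun u => \sum_(l < m) c l * bas (w l) u).
    elim: (index_enum _) => [|i r IHr].
      by apply: graph_eq graph0; [rewrite big_nil|move=> u; rewrite big_nil].
    apply: graph_eq (graphD (graphZ (c i) (gT (w i))) IHr).
      by rewrite big_cons.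
    by move=> u; rewrite big_cons.
  rewrite sum0 in g; have := graph_right0 g (w l).
  rewrite (bigD1 l) //= (GTbasisE (Sw l)) mulr1 big1 ?addr0 // => i il.
  rewrite /GTbasis asboolF ?mulr0 // => -[_ /winj e].
  by rewrite e eqxx in il.
- move=> x; have [phi g] := graph_total x; have [s phiE] := graph_fin g.
  pose Sb u := `[< S u >].
  pose p0 : C * arr R := (0, top).
  (* List entries outside the set are replaced by [top] with coefficient 0, as every array of the
     combination must belong to the set. *)
  exists (size s), (fun l => if Sb (nth p0 s l).2 then (nth p0 s l).2 else top).
  exists (fun l => if Sb (nth p0 s l).2 then (nth p0 s l).1 else 0); split.
    move=> l; case: ifP => [/asboolP //|_]; exact: top_GTset.
  apply: graph_inj g _; rewrite phiE {phiE}.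
  have h : graph (\sum_(p <- s) p.1 *: T p.2) (basis_sum n a s).
    elim: s => [|p s IHs].
      by apply: graph_eq graph0; [rewrite big_nil|move=> u; rewrite /basis_sum big_nil].
    apply: graph_eq (graphD (graphZ p.1 (gT p.2)) IHs); first by rewrite big_cons.
    by move=> u; rewrite /basis_sum big_cons.
  apply: graph_eq h => //; rewrite (big_nth p0) big_mkord; apply: eq_bigr => l _.
  rewrite /Sb; case: asboolP => // nS; rewrite scale0r.
  rewrite (_ : T _ = 0) ?scaler0 //; apply: graph_left0; apply: graph_eq (gT _) => // u.
  by rewrite GTbasis_out.
- move=> k kn v Sv; split.
  + apply: (graph_inj (graph_e kn (gT v))); rewrite GTe_basis //.
    apply: graph_eq (graphZ (-1) (graph_sum
      (F := fun i => coef_e v k i *: T (arr_add v (delta R k i))) (index_iota 1 k.+1) (fun i => graphZ (coef_e v k i) (gT (arr_add v (delta R k i)))))).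
      by rewrite scaleN1r.
    by move=> w; rewrite mulN1r.
  + apply: (graph_inj (graph_f kn (gT v))); rewrite GTf_basis //.
    exact: (graph_sum (F := fun i => coef_f v k i *: T (arr_sub v (delta R k i)))
      (index_iota 1 k.+1) (fun i => graphZ (coef_f v k i) (gT (arr_sub v (delta R k i))))).
  + apply: (graph_inj (graph_h kn (gT v))).
    apply: graph_eq (graphZ (coef_h v k) (gT v)) => // w.
    by rewrite /GTbasis; case: asboolP => [[_ ->] //|_]; rewrite !mulr0.
Qed.

End HighestWeight.

(** * Elements of the extended Weyl group as automorphisms, and twisted modules *)

Section Automorphisms.
Variable R : realType.
Local Notation C := R[i].
Variable n : nat.
Local Notation M := 'M[C]_(n.+1).

(** Writing x as u(ui x) with [ui x] traceless turns submodules of the twisted module into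
    submodules of the original one. *)
Definition lie_automorphism (u ui : M -> M) : Prop :=
  [/\ forall c x y, u (c *: x + y) = c *: u x + u y,
      forall x y, u (lie x y) = lie (u x) (u y),
      forall x, sl x -> sl (u x), forall x, sl x -> sl (ui x)
    & cancel ui u].

Lemma lie_automorphism_comp u ui w wi : lie_automorphism u ui -> lie_automorphism w wi ->
  lie_automorphism (u \o w) (wi \o ui).
Proof.
move=> [u1 u2 u3 u4 u5] [w1 w2 w3 w4 w5]; split=> /= [c x y|x y|x /w3/u3|x /u4/w4|x] //.
- by rewrite w1 u1.
- by rewrite w2 u2.
- by rewrite /= w5 u5.
Qed.

Lemma lie_automorphism_comp3 u ui w wi z zi :
  lie_automorphism u ui -> lie_automorphism w wi -> lie_automorphism z zi ->
  lie_automorphism (u \o w \o z) (zi \o wi \o ui).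
Proof.
by move=> au aw az; apply: (lie_automorphism_comp (lie_automorphism_comp au aw) az).
Qed.

Lemma lie_automorphism_conj (g gi : M) : g *m gi = 1%:M -> gi *m g = 1%:M ->
  lie_automorphism (fun y => g *m y *m gi) (fun y => gi *m y *m g).
Proof.
move=> ggi gig.
have M2 x y : (g *m x *m gi) *m (g *m y *m gi) = g *m (x *m y) *m gi.
  by rewrite !mulmxA -(mulmxA (g *m x)) gig mulmx1.
split=> [c x y|x y|x sx|x sx|x].
- by rewrite mulmxDr mulmxDl -scalemxAr -scalemxAl.
- by rewrite /lie !M2 mulmxBr mulmxBl.
- by rewrite /sl -mulmxA mxtrace_mulC -mulmxA gig mulmx1.
- by rewrite /sl -mulmxA mxtrace_mulC -mulmxA ggi mulmx1.
- by rewrite !mulmxA ggi mul1mx -mulmxA ggi mulmx1.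
Qed.

(** For x^2 = 0 the cube of ad x vanishes and its square sends y to -2xyx, so exp(ad x) is
    conjugation by 1 + x. *)
Lemma expadE (x y : M) : (1 <= n)%N -> x *m x = 0 ->
  expad x y = (1%:M + x) *m y *m (1%:M - x).
Proof.
move=> n1 xx; rewrite /expad.
have lie2 z : lie x (lie x z) = - (2 *: (x *m z *m x)).
  rewrite /lie mulmxBr mulmxBl !mulmxA xx mul0mx sub0r -[z *m x *m x]mulmxA xx mulmx0.
  by rewrite subr0 scaler_nat mulr2n opprD.
have lie3 z : lie x (lie x (lie x z)) = 0.
  rewrite lie2 /lie mulmxBr mulmxBl !mulmxA xx !mul0mx -[_ *m x *m x]mulmxA xx mulmx0.
  by rewrite subrr scaler0 oppr0.
(* The bound n >= 1 ensures that the terms of order 0, 1 and 2 all occur in the truncated series. *)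
have -> : (2 * n).+2 = (2 * n).-1.+3 by lia.
rewrite !big_ord_recl big1 => [|i _] /=; last first.
  by rewrite lie3 scaler0.
rewrite !fact0 invr1 !scale1r addr0 lie2 scalerN scalerA mulVf ?pnatr_eq0 // scale1r.
rewrite mulmxDl mul1mx mulmxBr mulmx1 mulmxDl /lie opprD.
by rewrite -!addrA.
Qed.

Lemma lie_automorphism_expad (x : M) : (1 <= n)%N -> x *m x = 0 ->
  lie_automorphism (expad x) (expad (- x)).
Proof.
move=> n1 xx.
have xN : (- x) *m (- x) = 0 by rewrite mulmxN mulNmx opprK.
have -> : expad x = (fun y => (1%:M + x) *m y *m (1%:M - x)).
  by apply: funext => y; apply: expadE.
have -> : expad (- x) = (fun y => (1%:M - x) *m y *m (1%:M + x)).
  by apply: funext => y; rewrite expadE // opprK.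
apply: lie_automorphism_conj.
  by rewrite mulmxBr mulmx1 mulmxDl mul1mx xx addr0 addrK.
by rewrite mulmxDr mulmx1 mulmxBl mul1mx xx subr0 subrK.
Qed.

Lemma gt_e_sq k : (1 <= k <= n)%N -> gt_e R n k *m gt_e R n k = 0.
Proof.
move=> kn; rewrite EuM; last by lia.
by rewrite (_ : (_ == _) = false) ?scale0r //; lia.
Qed.

Lemma gt_f_sq k : (1 <= k <= n)%N -> gt_f R n k *m gt_f R n k = 0.
Proof.
move=> kn; rewrite EuM; last by lia.
by rewrite (_ : (_ == _) = false) ?scale0r //; lia.
Qed.

Lemma sqN (x : M) : x *m x = 0 -> (- x) *m (- x) = 0.
Proof. by move=> xx; rewrite mulmxN mulNmx opprK. Qed.

Lemma lie_automorphism_rW k : (1 <= k <= n)%N -> lie_automorphism (rW k) (rWinv k).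
Proof.
move=> kn; have n1 : (1 <= n)%N by lia.
have ef := lie_automorphism_expad n1 (gt_f_sq kn).
have := lie_automorphism_expad n1 (sqN (gt_e_sq kn)); rewrite opprK => ee.
rewrite /rW /rWinv; exact: lie_automorphism_comp3.
Qed.

Lemma lie_automorphism_rWinv k : (1 <= k <= n)%N -> lie_automorphism (rWinv k) (rW k).
Proof.
move=> kn; have n1 : (1 <= n)%N by lia.
have ee := lie_automorphism_expad n1 (gt_e_sq kn).
have := lie_automorphism_expad n1 (sqN (gt_f_sq kn)); rewrite opprK => ef.
rewrite /rW /rWinv; exact: lie_automorphism_comp3.
Qed.

Local Notation J := (Jmx R n).

Lemma Jmx_tr : J^T *m J = 1%:M.
Proof.
apply/matrixP => a b; rewrite !mxE (bigD1 (rev_ord a)) //= big1 ?addr0.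
  rewrite !mxE /= (_ : (n.+1 - a.+1 + a == n)%N); last by have := ltn_ord a; lia.
  rewrite (_ : (n.+1 - a.+1 + b == n)%N = (a == b)); last first.
    by rewrite -val_eqE /=; have := ltn_ord a; have := ltn_ord b; lia.
  by case: eqP => _; rewrite ?mulr0 // -expr2 sqrr_sign.
move=> c ca; rewrite !mxE (_ : (c + a == n)%N = false) ?mul0r //.
apply: contraNF ca => /eqP e; rewrite -val_eqE /=; apply/eqP.
by have := ltn_ord a; lia.
Qed.

Lemma Jmx_trE : J^T = (-1) ^+ n *: J.
Proof.
apply/matrixP => a b; rewrite !mxE addnC.
case: eqP => [e|_]; last by rewrite mulr0.
rewrite -exprD -signr_odd -[RHS]signr_odd; congr (_ ^+ nat_of_bool _).
by move/(congr1 odd): e; rewrite !oddD !oddS => <-; do 2 case: odd.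
Qed.

(** Negative transposition preserves brackets because transposition reverses products, and J is
    orthogonal. Applying the map twice gives conjugation by J^2 = (-1)^n, whose two signs cancel. *)
Lemma lie_automorphism_sigmaW : lie_automorphism (@sigmaW R n) (@sigmaW R n).
Proof.
have M2 (x y : M) : (J *m x *m J^T) *m (J *m y *m J^T) = J *m (x *m y) *m J^T.
  by rewrite !mulmxA -(mulmxA (J *m x)) Jmx_tr mulmx1.
have slS (x : M) : sl x -> sl (sigmaW x).
  move=> sx; rewrite /sl /sigmaW raddfN /= -mulmxA mxtrace_mulC -mulmxA Jmx_tr mulmx1.
  by rewrite mxtrace_tr sx oppr0.
split=> // [c x y|x y|x].
- rewrite /sigmaW linearP /= mulmxDr mulmxDl -scalemxAr -scalemxAl opprD scalerN //.
- rewrite /sigmaW /lie !mulmxN !mulNmx !opprK !M2 linearB /= !trmx_mul.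
  by rewrite mulmxBr mulmxBl opprB.
- rewrite /sigmaW linearN /= mulmxN mulNmx opprK !trmx_mul !trmxK.
  have JJ : J *m J = (-1) ^+ n *: 1%:M.
    have JE : J = (-1) ^+ n *: J^T by rewrite Jmx_trE scalerA -expr2 sqrr_sign scale1r.
    by rewrite {1}JE -scalemxAl Jmx_tr.
  have JJt : J^T *m J^T = (-1) ^+ n *: 1%:M.
    by rewrite -trmx_mul JJ linearZ /= trmx1.
  rewrite !mulmxA JJ -!mulmxA JJt -scalemxAl mul1mx -scalemxAr mulmx1 scalerA.
  by rewrite -expr2 sqrr_sign scale1r.
Qed.

Lemma Wbar_automorphism u ui : Wbar u ui -> lie_automorphism u ui.
Proof.
elim=> [|w wi k kn _ IH|w wi k kn _ IH|w wi _ IH].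
- by split.
- exact: (lie_automorphism_comp IH (lie_automorphism_rW kn)).
- exact: (lie_automorphism_comp IH (lie_automorphism_rWinv kn)).
- exact: (lie_automorphism_comp IH lie_automorphism_sigmaW).
Qed.

Variables (V : lmodType C) (rho : M -> V -> V) (u ui : M -> M).
Hypothesis aut : lie_automorphism u ui.

Lemma gmod_twist : is_gmod rho -> is_gmod (twist_by_inv rho u).
Proof.
have [lin br slu _ _] := aut; move=> [g1 g2 g3]; rewrite /twist_by_inv.
split=> [x c v w|x y c v sx sy|x y v sx sy]; first exact: g1.
- by rewrite lin g2 //; apply: slu.
- by rewrite br g3 //; apply: slu.
Qed.

Lemma simple_twist : simple_gmod rho -> simple_gmod (twist_by_inv rho u).
Proof.
have [_ _ _ slui uK] := aut; move=> [nz simp]; split=> // U [U0 UD UZ Ur].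
apply: simp; split=> // x v sx Uv; rewrite -[x]uK.
by apply: (Ur (ui x)) => //; apply: slui.
Qed.

End Automorphisms.

(** * Arithmetic of admissible weights *)

Section AdmissibleWeights.
Variable R : realType.
Local Notation C := R[i].
Variables (n p q : nat).

Lemma epsc_diff (c : 'I_n -> C) (a b : 'I_n.+1) : (a < b)%N ->
  epsc c a - epsc c b = \sum_(i < n | (a <= i < b)%N) c i.
Proof.
move=> ab; rewrite /epsc (bigID (fun i : 'I_n => (i < b)%N)) /=.
rewrite [X in _ + X - _](eq_bigl (fun i : 'I_n => (b <= i)%N)) ?addrK // => i.
by rewrite -leqNgt; case: (leqP b i) => bi; rewrite ?andbF ?andbT //; lia.
Qed.

(** Coordinates of mu - (p/q) eta + rho; permuting them by w gives lambda + rho, since the dot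
    action is centred at -rho. *)
Definition shifted_weight (mu : 'I_n -> nat) (eta : 'I_n -> int) (b : 'I_n.+1) : C :=
  epsc (fun i => (mu i)%:R) b - (p%:R / q%:R) * epsc (fun i => (eta i)%:~R) b
  + rho_eps R b.

Lemma shifted_weight_diff mu eta (a b : 'I_n.+1) : (a < b)%N ->
  shifted_weight mu eta a - shifted_weight mu eta b =
  (\sum_(i < n | (a <= i < b)%N) mu i + (b - a))%N%:R
    - (p%:R / q%:R) * (\sum_(i < n | (a <= i < b)%N) eta i)%:~R.
Proof.
move=> ab; rewrite natrD natr_sum rmorph_sum /= -!epsc_diff // /shifted_weight /rho_eps.
have -> : (n - a)%N = (n - b + (b - a))%N by have := ltn_ord b; lia.
by rewrite natrD; ring.
Qed.

Hypotheses (q0 : (0 < q)%N) (pq : coprime p q).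

(** Clearing denominators shows that q divides p s, hence s by coprimality. *)
Lemma integral_difference (X : nat) (s t : int) :
  X%:R - (p%:R / q%:R) * s%:~R = t%:~R :> C ->
  exists2 m : int, s = m * q%:Z & X%:Z - t = p%:Z * m.
Proof.
move=> e; have qN0 : q%:R != 0 :> C by rewrite pnatr_eq0; lia.
have {}e : (X%:Z - t) * q%:Z = p%:Z * s.
  apply: (@intr_inj C); rewrite !rmorphM rmorphB /= -e.
  by rewrite /= !pmulrn; field.
have : (q%:Z %| p%:Z * s)%Z by rewrite -e dvdz_mull.
rewrite Gauss_dvdzr => [/dvdzP[m sE]|]; last by rewrite coprimezE /= coprime_sym.
exists m => //; apply: (@mulIf _ q%:Z); first by lia.
by rewrite e sE mulrA.
Qed.

(** An integral difference forces q to divide s = (eta, alpha), and the range in C(w, eta) then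
    leaves a single value of s for each sign of w(alpha). *)
Lemma shifted_weight_regular mu eta (w : 'S_n.+1) : (n.+1 <= p)%N ->
  (\sum_i mu i <= p - n.+1)%N -> Ccond q w eta ->
  forall i j : 'I_n.+1, (i < j)%N ->
  ~ natle (shifted_weight mu eta ((w^-1)%g i)) (shifted_weight mu eta ((w^-1)%g j)).
Proof.
move=> np muP Cw i j ij [t e].
have muX (a b : 'I_n.+1) : (\sum_(i < n | (a <= i < b)%N) mu i <= p - n.+1)%N.
  apply: leq_trans muP; rewrite [leqRHS](bigID (fun i : 'I_n => (a <= i < b)%N)) /=.
  exact: leq_addr.
set a := (w^-1)%g i in e; set b := (w^-1)%g j in e.
have wa : w a = i by rewrite permKV.
have wb : w b = j by rewrite permKV.
have := ltn_ord a; have := ltn_ord b => bn an.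
case: (ltngtP a b) => [ab|ba|/ord_inj ab]; last by move: ij; rewrite -wa -wb ab ltnn.
- have := Cw a b ab; rewrite wa wb ij /=; set s := \sum_(_ < _ | _) _ => -[s0 sq].
  have := shifted_weight_diff mu eta ab.
  rewrite e opprD addrA subrr sub0r -/s => /esym.
  rewrite -[t%:R]/(t%:Z%:~R) -mulrNz => /integral_difference[m sE tE].
  (* Here 0 <= s < q, so s = 0, and the difference at [a] minus that at [b] is at least b - a > 0
     instead of -t. *)
  have m0 : m = 0 by nia.
  by move: tE; rewrite m0 mulr0; lia.
- have := Cw b a ba; rewrite wa wb ltnNge (ltnW ij) /=.
  set s := \sum_(_ < _ | _) _ => -[s1 sq].
  have := shifted_weight_diff mu eta ba.
  rewrite e addrAC subrr add0r -/s => /esym.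
  rewrite -[t%:R]/(t%:Z%:~R) => /integral_difference[m sE tE].
  (* Here 1 <= s <= q, so s = q and t = X - p, which is negative because X is at most (p - n - 1) +
     n. *)
  have m1 : m = 1 by nia.
  by move: tE (muX b a); rewrite m1 mulr1; lia.
Qed.

End AdmissibleWeights.

Lemma wt_val_gt_h (R : realType) n (c : 'I_n.+1 -> R[i]) k : (1 <= k <= n)%N ->
  wt_val c (gt_h R n k) = c (inord k.-1) - c (inord k).
Proof.
move=> kn; have val1 : (inord k.-1 : 'I_n.+1) = k.-1 :> nat by rewrite inordK //; lia.
have val2 : (inord k : 'I_n.+1) = k :> nat by rewrite inordK //; lia.
have sumE m (i0 : 'I_n.+1) : i0 = m :> nat -> \sum_i c i * Eu R n m.+1 m.+1 i i = c i0.
  move=> <-; rewrite (bigD1 i0) //= mxE eqxx mulr1 big1 ?addr0 // => i ne.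
  by rewrite mxE /= (negbTE (_ : (i : nat) != i0)) ?mulr0.
rewrite /wt_val -(sumE _ _ val1) -(sumE _ _ val2) -sumrB; apply: eq_bigr => i _.
by rewrite -mulrBr prednK; [rewrite !mxE|lia].
Qed.

(** * From admissible weights to the two claims on modules *)

Lemma admissible_strongly_tame (R : realType) (n p q : nat) (lam : 'M[R[i]]_(n.+1) -> R[i]) :
  (0 < q)%N -> coprime p q -> (n.+1 <= p)%N -> in_Prbar p q lam ->
  forall (V : lmodType R[i]) (rho : 'M[R[i]]_(n.+1) -> V -> V),
      is_gmod rho -> simple_gmod rho -> (exists v, hw_vector rho id lam v) ->
      strongly_tame_GT rho.
Proof.
move=> q0 pq np [mu [w [eta [muP Cw lamE]]]] V rho gm simple [v0 hw].
pose A (b : 'I_n.+1) : R[i] := shifted_weight R p q mu eta ((w^-1)%g b).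
(* The sequence [a] is lambda + rho, read with indices starting at 1 while coordinates start at
   0. *)
apply: (highest_weight_strongly_tame gm simple hw (a := fun i => A (inord i.-1))).
  move=> i j ij jn; apply: shifted_weight_regular => //.
  by rewrite !inordK; lia.
move=> k kn; rewrite lamE; last exact: cartan_gt_h.
rewrite wt_val_gt_h // /dot_act /wact /rho_eps !inordK; [|lia|lia].
rewrite succnK (_ : (n - k.-1 = (n - k).+1)%N); last by lia.
by rewrite -[(n - k).+1%:R]natr1 /A /shifted_weight /rho_eps; ring.
Qed.

Theorem mainTheorem14 (R : realType) (n p q : nat) (lam : 'M[R[i]]_(n.+1) -> R[i]) :
  (1 <= n)%N -> (0 < q)%N -> coprime p q -> (n.+1 <= p)%N ->
  in_Prbar p q lam ->
  (forall (V : lmodType R[i]) (rho : 'M[R[i]]_(n.+1) -> V -> V),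
      is_gmod rho -> simple_gmod rho -> (exists v, hw_vector rho id lam v) ->
      strongly_tame_GT rho) /\
  (forall (u ui : 'M[R[i]]_(n.+1) -> 'M[R[i]]_(n.+1)), Wbar u ui ->
   forall (V : lmodType R[i]) (rho : 'M[R[i]]_(n.+1) -> V -> V),
      is_gmod rho -> simple_gmod rho -> (exists v, hw_vector rho u lam v) ->
      strongly_tame_GT_base rho ui).
Proof.
move=> n1 q0 pq np lamP; have tame := admissible_strongly_tame q0 pq np lamP.
split=> [|u ui Wu V rho gm simple hw]; first exact: tame.
have aut := Wbar_automorphism Wu.
(* Unfolding the twist, a highest weight vector for u(b) of weight u(lambda) is one for b of weight
   lambda in the twisted module, so the first claim applies to it. *)
exists u, ui; split=> //; apply: tame hw; [exact: gmod_twist aut gm|exact: simple_twist aut simple].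
Qed.
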